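(* Let $H$ be a complex Hilbert space of dimension $n$, possibly infinite, with a fixed conjugation and associated transposition $x \mapsto x^t$ on $\mathcal{B}(H)$. Let $E$ denote (a) $S_n = \{x \in \mathcal{B}(H) : x^t = x\}$ where $2 \leq n \leq \infty$, or (b) $A_n = \{x \in \mathcal{B}(H) : x^t = -x\}$ where $5 \leq n \leq \infty$. Then $E$ is universally reversible and its universal TRO is $(T^*(E), \alpha_E) = (\mathcal{B}(H), \mathrm{inclusion})$.
   Context: Given a conjugation $\xi\mapsto\bar\xi$ on $H$ (a conjugate-linear isometric involution), the transposition is defined by $x^t(\xi) = \overline{x^*(\bar\xi)}$. The dimension of $H$ is the cardinality of an orthonormal basis, arbitrary infinite cardinals being allowed. A TRO is a norm closed subspace of a $C^*$-algebra closed under $[a,b,c] = ab^*c$; a TRO homomorphism is a linear map preserving this product. A $JC^*$-triple is a complex Banach space $E$ linearly isometric to a norm closed subspace $F$ of a TRO closed under $\{a,b,c\} = \tfrac12(ab^*c + cb^*a)$; the triple product transported to $E$ is independent of the choice of $F$ and of the isometry. A triple homomorphism is a linear map preserving triple products. The universal TRO of a $JC^*$-triple $E$ is the pair $(T^*(E),\alpha_E)$, unique up to TRO isomorphism compatible with the embeddings, where $T^*(E)$ is a TRO, $\alpha_E \colon E \to T^*(E)$ is an injective triple homomorphism whose image generates $T^*(E)$ as a TRO, and for every triple homomorphism $\pi \colon E \to T$ into a TRO there is a unique TRO homomorphism $\tilde\pi \colon T^*(E) \to T$ with $\tilde\pi\circ\alpha_E = \pi$. $E$ is universally reversible if $\alpha_E(E)$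 is reversible in $T^*(E)$, that is, $a_1 a_2^* a_3 \cdots a_{2k}^* a_{2k+1} + a_{2k+1} a_{2k}^* \cdots a_2^* a_1 \in \alpha_E(E)$ whenever $a_1, \ldots, a_{2k+1} \in \alpha_E(E)$ and $k\ge 1$. *)

(* Defs.v *)
From HB Require Import structures.
From mathcomp Require Import all_boot all_order all_algebra sesquilinear.
From mathcomp Require Import complex.
From mathcomp Require Import all_classical all_reals interval_inference.
From mathcomp Require Import topology normedtype.
From mathcomp Require Import ring lra.

Set Implicit Arguments.
Unset Strict Implicit.
Unset Printing Implicit Defensive.

Import Order.TTheory GRing.Theory Num.Theory.
Import numFieldNormedType.Exports.

Local Open Scope classical_set_scope.
Local Open Scope complex_scope.
Local Open Scope ring_scope.

HB.mixin Record isHilbert (R : realType) H & CompleteNormedModule R[i] H := {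
  (* linear in the first argument, conjugate-linear in the second *)
  inner : {dot H for @Num.conj R[i]} ;
  innerE : forall x, inner x x = `|x| ^+ 2 }.

#[short(type="hilbertType")]
HB.structure Definition Hilbert (R : realType) :=
  { H of isHilbert R H & CompleteNormedModule R[i] H }.

(* C*-algebras need not be unital, hence the product is not taken from the
   (unital) ring structures of the library. *)
HB.mixin Record isCStarAlgebra (R : realType) A
    & CompleteNormedModule R[i] A := {
  cmul : A -> A -> A ;
  cstar : A -> A ;
  cmulA : associative cmul ;
  cmul_linearl : forall b, linear (cmul^~ b) ;
  cmul_linearr : forall a, linear (cmul a) ;
  cnormM : forall a b, `|cmul a b| <= `|a| * `|b| ;
  cstar_antilinear : forall (k : R[i]) a b,
    cstar (k *: a + b) = k^* *: cstar a + cstar b ;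
  cstarK : involutive cstar ;
  cstarM : forall a b, cstar (cmul a b) = cmul (cstar b) (cstar a) ;
  cnorm_star : forall a, `|cmul (cstar a) a| = `|a| ^+ 2 }.

#[short(type="cstarAlgType")]
HB.structure Definition CStarAlgebra (R : realType) :=
  { A of isCStarAlgebra R A & CompleteNormedModule R[i] A }.

Section RealNorm.
Variables (R : realType) (V : normedModType R[i]).
Implicit Types x y : V.

(* In a normed module over R[i] norms take their values in R[i]; rnorm is the
   same norm read in R. *)
Definition rnorm x : R := complex.Re `|x|.

Lemma rnormE x : `|x| = (rnorm x)%:C.
Proof. by rewrite RRe_real// normr_real. Qed.

Lemma rnorm_ge0 x : 0 <= rnorm x.
Proof. by rewrite -ler0c -rnormE. Qed.

Lemma ler_rnormD x y : rnorm (x + y) <= rnorm x + rnorm y.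
Proof. by rewrite -lecR rmorphD /= -!rnormE ler_normD. Qed.

Lemma rnormZ (a : R[i]) x : rnorm (a *: x) = complex.Re `|a| * rnorm x.
Proof.
by apply: complexI; rewrite rmorphM /= -!rnormE normrZ.
Qed.

Lemma rnormN x : rnorm (- x) = rnorm x.
Proof. by rewrite /rnorm normrN. Qed.

Lemma rnormB x y : rnorm (x - y) = rnorm (y - x).
Proof. by rewrite /rnorm distrC. Qed.

Lemma rnorm0 : rnorm 0 = 0.
Proof. by rewrite /rnorm normr0. Qed.

Lemma rnorm0_eq0 x : rnorm x = 0 -> x = 0.
Proof. by move=> x0; apply/normr0_eq0; rewrite rnormE x0. Qed.

Lemma rnormZr (t : R) x : rnorm (t%:C *: x) = `|t| * rnorm x.
Proof. by rewrite rnormZ normc_def /= expr0n addr0 sqrtr_sqr. Qed.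

Lemma closed_rnorm (A : set V) :
  (forall x, (forall e : R, 0 < e -> exists2 y, A y & rnorm (x - y) < e) -> A x)
  -> closed A.
Proof.
move=> h x /= clx; apply: h => e e0.
have [y [Ay]] := clx _ (nbhsx_ballx x e%:C (eq_ind_r is_true e0 (ltcR 0 e : (0 < e%:C) = _))).
rewrite -ball_normE /= rnormE ltcR => xy.
by exists y.
Qed.

End RealNorm.

Lemma bounded_continuous (R : realType) (V W : normedModType R[i]) (f : V -> W) :
  linear f -> continuous f <-> exists M : R, forall x, rnorm (f x) <= M * rnorm x.
Proof.
move=> lf; pose g : {linear V -> W} :=
  HB.pack f (GRing.isLinear.Build _ _ _ _ _ lf).
rewrite -[f]/(g : V -> W) -linear_bounded_continuous; split.
  move=> /linear_boundedP [M [/complex_realP[m ->] Mf]].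
  exists (m + 1) => x; rewrite -lecR rmorphM /= -!rnormE; apply: Mf.
  by rewrite ltcR ltrDl.
move=> [M Mf]; apply/linear_boundedP; exists M%:C; split.
  by apply/complex_realP; exists M.
move=> r Mr x; rewrite (le_trans (y := M%:C * `|x|))//.
  by rewrite !rnormE -rmorphM lecR.
by rewrite ler_wpM2r// ltW.
Qed.

Section Inner.
Variables (R : realType) (H : hilbertType R).
Implicit Types x y z : H.

Lemma innerC x y : inner x y = (inner y x)^*.
Proof. by rewrite hermC expr0 mul1r. Qed.

Lemma inner_rnorm x : inner x x = (rnorm x ^+ 2)%:C.
Proof. by rewrite innerE rnormE rmorphXn. Qed.

Lemma innerDl x y z : inner (x + y) z = inner x z + inner y z.
Proof. exact: linearDl. Qed.
Lemma innerDr x y z : inner z (x + y) = inner z x + inner z y.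
Proof. exact: linearDr. Qed.
Lemma innerZl (a : R[i]) x z : inner (a *: x) z = a * inner x z.
Proof. by rewrite linearZl_LR. Qed.
Lemma innerZr (a : R[i]) x z : inner z (a *: x) = a^* * inner z x.
Proof. by rewrite linearZr_LR. Qed.
Lemma innerNl x z : inner (- x) z = - inner x z.
Proof. exact: linearNl. Qed.
Lemma innerNr x z : inner z (- x) = - inner z x.
Proof. exact: linearNr. Qed.
Lemma innerBl x y z : inner (x - y) z = inner x z - inner y z.
Proof. exact: linearBl. Qed.
Lemma innerBr x y z : inner z (x - y) = inner z x - inner z y.
Proof. exact: linearBr. Qed.
Lemma inner0l z : inner 0 z = 0.
Proof. exact: linear0l. Qed.
Lemma inner0r z : inner z 0 = 0.
Proof. exact: linear0r. Qed.

Lemma inner_ext x y : (forall z, inner z x = inner z y) -> x = y.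
Proof.
move=> h; apply/eqP; rewrite -subr_eq0 -normr_eq0 -sqrf_eq0 -innerE.
by rewrite innerBr h subrr.
Qed.

Lemma Re_innerC x y : complex.Re (inner x y) = complex.Re (inner y x).
Proof. by rewrite innerC; case: (inner y x). Qed.

Lemma addcJr (c : R[i]) : c + c^* = (2 * complex.Re c)%:C.
Proof. by rewrite -[c^*]/(c^*)%C addcJ rmorphM /= rmorph_nat. Qed.

Lemma rnormD_sqr x y : rnorm (x + y) ^+ 2 =
  rnorm x ^+ 2 + rnorm y ^+ 2 + 2 * complex.Re (inner x y).
Proof.
apply: complexI; rewrite -inner_rnorm innerDl !innerDr (innerC y x).
have -> : forall a b c : R, (a + b + c)%:C = a%:C + b%:C + c%:C.
  by move=> *; rewrite !rmorphD.
by rewrite -!inner_rnorm -addcJr; ring.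
Qed.

Lemma cauchy_schwarz x y : complex.Re `|inner x y| <= rnorm x * rnorm y.
Proof.
have [->|y0] := eqVneq y 0.
  by rewrite inner0r normr0 mulr_ge0 ?rnorm_ge0.
pose z := inner y y *: x - inner x y *: y.
have : 0 <= inner z z by rewrite inner_rnorm ler0c sqr_ge0.
have -> : inner z z = inner y y * (inner x x * inner y y - `|inner x y| ^+ 2).
  rewrite /z innerBl !innerBr !innerZl !innerZr sqr_normc.
  rewrite (innerC y x); set c := inner x y; rewrite inner_rnorm.
  rewrite (_ : ((rnorm y ^+ 2)%:C)^* = (rnorm y ^+ 2)%:C); last exact: conjc_real.
  by rewrite -[(c^*)%R]/(c^*)%C; ring.
have ygt0 : 0 < inner y y by rewrite innerE exprn_gt0// normr_gt0.
rewrite pmulr_rge0// subr_ge0 !inner_rnorm -[`|inner x y|]RRe_real ?normr_real// -!rmorphM.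
rewrite -rmorphXn lecR -exprMn ler_pXn2r// nnegrE ?mulr_ge0 ?rnorm_ge0//.
by rewrite -ler0c RRe_real ?normr_real.
Qed.

Lemma Re_inner_le x y : complex.Re (inner x y) <= rnorm x * rnorm y.
Proof.
apply: le_trans (cauchy_schwarz x y).
rewrite (le_trans (ler_norm _))// -lecR RRe_real ?normr_real ?normc_ge_Re//.
Qed.

Lemma rnorm_inner_le (M : R) x : 0 <= M ->
  (forall y, complex.Re (inner x y) <= M * rnorm y) -> rnorm x <= M.
Proof.
move=> M0 /(_ x); rewrite inner_rnorm [complex.Re _]/= expr2.
have [x0|] := ltP 0 (rnorm x); first by rewrite ler_pM2r.
by move=> x0 _; rewrite (le_trans x0).
Qed.

End Inner.

Lemma ex_natSinv (R : realType) (e : R) : 0 < e ->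
  exists N, forall n, (N <= n)%N -> n.+1%:R^-1 < e.
Proof.
move: e => _ /posnumP[e]; have [N _ Ne] := near_infty_natSinv_lt e.
by exists N => n Nn; apply: Ne.
Qed.

Lemma cvg_rnorm (R : realType) (V : normedModType R[i]) (u : nat -> V) (y : V) :
  u @ \oo --> y <->
  forall e : R, 0 < e -> exists N, forall n, (N <= n)%N -> rnorm (y - u n) < e.
Proof.
split=> [/cvgrPdist_lt h e e0|h].
  have [|N _ Ne] := h e%:C; first by rewrite ltcR.
  by exists N => n Nn; have := Ne n Nn; rewrite /= rnormE ltcR.
apply/cvgrPdist_lt => e e0.
have [r re] : exists r : R, e = r%:C by apply/complex_realP; rewrite realE ltW.
move: e0; rewrite re ltcR => r0; have [N Nr] := h _ r0.
by exists N => // n /Nr; rewrite /= rnormE ltcR.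
Qed.

Lemma ReB (R : realType) (a b : R[i]) :
  complex.Re (a - b) = complex.Re a - complex.Re b.
Proof. by case: a b => ? ? [? ?]. Qed.

Lemma variation_arith (R : realFieldType) (m p q a b F I Y t e s : R) :
  m <= p + t ^+ 2 * a + 2 * (t * I) - 2 * (t * F) -> p < m + q -> q < e ->
  t * (I - Y) <= s * e * b ->
  - e * (1 + 2 * s * b) <= t ^+ 2 * a + 2 * t * (Y - F).
Proof. move=> h1 h2 h3 h4; lra. Qed.

Section Riesz.
Variables (R : realType) (H : hilbertType R).
Variable f : H -> R[i].
Hypothesis lf : forall (a : R[i]) x y, f (a *: x + y) = a * f x + f y.
Variable M : R.
Hypothesis fM : forall x, complex.Re `|f x| <= M * rnorm x.
Implicit Types x y : H.

Let f0 : f 0 = 0.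
Proof.
by apply: (@addrI _ (f 0)); rewrite addr0 -{1}[f 0]mul1r -lf scaler0 addr0.
Qed.
Let fZ (a : R[i]) x : f (a *: x) = a * f x.
Proof. by rewrite -[a *: x]addr0 lf f0 addr0. Qed.
Let fD x y : f (x + y) = f x + f y.
Proof. by rewrite -[x in LHS]scale1r lf mul1r. Qed.

Let Ref_le x : complex.Re (f x) <= M * rnorm x.
Proof.
apply: le_trans (fM x).
rewrite (le_trans (ler_norm _))// -lecR RRe_real ?normr_real ?normc_ge_Re//.
Qed.

Let phi x : R := rnorm x ^+ 2 - 2 * complex.Re (f x).

Let phi_lb x : - M ^+ 2 <= phi x.
Proof.
rewrite /phi; have := Ref_le x; have := sqr_ge0 (rnorm x - M).
rewrite sqrrB; set a := rnorm x; set b := complex.Re _; lra.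
Qed.

Let S := range phi.
Let hasS : has_inf S.
Proof.
split; first by exists (phi 0); exists 0.
by exists (- M ^+ 2) => _ [x _ <-]; exact: phi_lb.
Qed.

Let m := inf S.
Let m_le x : m <= phi x.
Proof. by apply: ge_inf; [case: hasS|exists x]. Qed.

Let ReD (a b : R[i]) : complex.Re (a + b) = complex.Re a + complex.Re b.
Proof. by case: a; case: b. Qed.
Let ReM (a : R) (b : R[i]) : complex.Re (a%:C * b) = a * complex.Re b.
Proof. by case: b => c d /=; rewrite mul0r subr0. Qed.

Let halfZ x : rnorm ((2^-1 : R)%:C *: x) = 2^-1 * rnorm x.
Proof. by rewrite rnormZr ger0_norm// invr_ge0. Qed.

Let par x y : rnorm (x - y) ^+ 2 <= 2 * (phi x + phi y - 2 * m).
Proof.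
have := m_le ((2^-1 : R)%:C *: (x + y)).
rewrite /phi halfZ fZ ReM fD ReD exprMn (rnormD_sqr x y).
rewrite (rnormD_sqr x (- y)) rnormN innerNr.
have -> : complex.Re (- inner x y) = - complex.Re (inner x y) by case: (inner x y).
lra.
Qed.

Let phiD x d : phi (x + d) =
  phi x + rnorm d ^+ 2 + 2 * complex.Re (inner x d) - 2 * complex.Re (f d).
Proof. by rewrite /phi rnormD_sqr fD ReD; ring. Qed.

Let approx (n : nat) : {x | phi x < m + n.+1%:R^-1}.
Proof.
apply/cid; have n0 : 0 < n.+1%:R^-1 :> R by rewrite invr_gt0.
by have [_ [x _ <-] ?] := inf_adherent n0 hasS; exists x.
Qed.

Let u n := sval (approx n).

Let u_phi n : phi (u n) < m + n.+1%:R^-1.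
Proof. exact: svalP (approx n). Qed.

Let u_near n k : rnorm (u n - u k) ^+ 2 <= 2 * (n.+1%:R^-1 + k.+1%:R^-1).
Proof.
rewrite (le_trans (par _ _))// ler_pM2l//.
move: (u_phi n) (u_phi k).
move: (phi (u n)) (phi (u k)) (n.+1%:R^-1) (k.+1%:R^-1) => a b c d; lra.
Qed.

Let u_cvg : cvg (u @ \oo).
Proof.
apply: cauchy_cvg; apply/cauchy_exP => e e0.
have [r re] : exists r : R, e = r%:C.
  by apply/complex_realP; rewrite realE ltW.
move: e0; rewrite re ltcR => r0.
have [N Nr] := ex_natSinv (divr_gt0 (exprn_gt0 2 r0) (ltr0n R 4)).
exists (u N); exists N => // n /= Nn; rewrite -ball_normE /= rnormE ltcR.
rewrite -(@ltr_pXn2r _ 2)// ?nnegrE ?rnorm_ge0 ?(ltW r0)//.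
rewrite (le_lt_trans (u_near _ _))//.
by move: (Nr N (leqnn N)) (Nr n Nn); move: (N.+1%:R^-1) (n.+1%:R^-1) => a b; lra.
Qed.

Let y := lim (u @ \oo).

Let uy e : 0 < e -> exists N, forall n, (N <= n)%N -> rnorm (y - u n) < e.
Proof. by move: e; exact/cvg_rnorm. Qed.

Let variation h (t e : R) : 0 < e ->
  - e * (1 + 2 * `|t| * rnorm h) <=
  t ^+ 2 * rnorm h ^+ 2 + 2 * t * (complex.Re (inner y h) - complex.Re (f h)).
Proof.
move=> e0; have [N1 N1e] := uy e0; have [N2 N2e] := ex_natSinv e0.
pose n := maxn N1 N2.
have {N1e} un : rnorm (y - u n) < e by apply: N1e; rewrite leq_maxl.
have {N2e} ne : n.+1%:R^-1 < e by apply: N2e; rewrite leq_maxr.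
have := m_le (u n + t%:C *: h); rewrite phiD fZ ReM rnormZr exprMn.
rewrite innerZr (_ : (t%:C)^* = t%:C); last exact: conjc_real.
rewrite ReM real_normK ?num_real// => le1.
have le2 : t * complex.Re (inner (u n - y) h) <= `|t| * e * rnorm h.
  rewrite -mulrA -ReM -[t%:C]conjc_real -[conjc _]/(t%:C^*)%R -innerZr.
  rewrite (le_trans (Re_inner_le _ _))// rnormZr mulrCA ler_wpM2l//.
  by rewrite ler_wpM2r ?rnorm_ge0// rnormB ltW.
have un' := u_phi n.
rewrite innerBl ReB in le2.
exact: variation_arith le1 un' ne le2.
Qed.

Let variation0 h : complex.Re (inner y h) = complex.Re (f h).
Proof.
apply/eqP; rewrite -subr_eq0; apply/eqP; set g := (_ - _).
have key t : 0 <= t ^+ 2 * rnorm h ^+ 2 + 2 * t * g.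
  apply/ler_addgt0Pl => e e0.
  pose k := 1 + 2 * `|t| * rnorm h.
  have k0 : 0 < k by rewrite ltr_pwDl// !mulr_ge0 ?rnorm_ge0.
  by have := variation h t (divr_gt0 e0 k0); rewrite -/k -/g mulNr divfK ?gt_eqF// lerNl; lra.
have a0 : 0 < rnorm h ^+ 2 + 1 by rewrite ltr_wpDl ?sqr_ge0.
have := key (- g / (rnorm h ^+ 2 + 1)).
set a := rnorm h ^+ 2 in a0 *.
rewrite (_ : _ + _ = - (g ^+ 2 * ((a + 2) / (a + 1) ^+ 2))); last first.
  by field; rewrite gt_eqF.
have c0 : 0 < (a + 2) / (a + 1) ^+ 2.
  by rewrite divr_gt0 ?exprn_gt0//; lra.
rewrite oppr_ge0 pmulr_lle0// => g0.
by apply/eqP; rewrite -sqrf_eq0 eq_le g0 sqr_ge0.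
Qed.

Lemma riesz : exists y, forall x, f x = inner x y.
Proof.
exists y => x; rewrite innerC.
have ReIm (z : R[i]) : complex.Im z = complex.Re ((- 'i)%C * z).
  by case: z => a b /=; ring.
have e1 := variation0 x; have := variation0 ((- 'i)%C *: x).
rewrite fZ -ReIm innerZr.
move: e1; case: (f x) => a b; case: (inner y x) => c d /= ->.
move=> h; rewrite -[RHS]/(a +i* - d); congr (_ +i* _); move: h; lra.
Qed.
End Riesz.

Definition bounded_op (R : realType) (H : hilbertType R) : {pred H -> H} :=
  fun f => `[< linear f /\ continuous f >].

Fact bounded_op_submod_closed (R : realType) (H : hilbertType R) :
  submod_closed (@bounded_op R H).
Proof.
split=> [|k f g /asboolP[lf cf] /asboolP[lg cg]].
  apply/asboolP; split=> [a x y|]; last exact: (@cst_continuous H H 0).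
  by rewrite -[LHS]/(0 : H) -[RHS]/(a *: 0 + 0 : H) scaler0 addr0.
apply/asboolP; split=> [a x y|x].
  rewrite -[LHS]/(k *: f (a *: x + y) + g (a *: x + y)).
  rewrite -[RHS]/(a *: (k *: f x + g x) + (k *: f y + g y)).
  by rewrite lf lg !scalerDr !scalerA [k * a]mulrC addrACA.
apply: (@continuousD _ _ _ (k \*: f) g); last exact: cg.
by apply: continuousZl_tmp; exact: cf.
Qed.

HB.instance Definition _ (R : realType) (H : hilbertType R) :=
  GRing.isSubmodClosed.Build R[i] (H -> H) (@bounded_op R H)
    (bounded_op_submod_closed H).

(* B(H) *)
Record bop (R : realType) (H : hilbertType R) := Bop {
  bop_fun :> H -> H ;
  _ : bop_fun \in @bounded_op R H }.

HB.instance Definition _ (R : realType) (H : hilbertType R) :=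
  [isSub of bop H for @bop_fun R H].
HB.instance Definition _ (R : realType) (H : hilbertType R) :=
  [Choice of bop H by <:].
HB.instance Definition _ (R : realType) (H : hilbertType R) :=
  [SubChoice_isSubLmodule of bop H by <:].

Section OperatorNorm.
Variables (R : realType) (H : hilbertType R).
Implicit Types (x y : bop H) (u v : H).

Lemma bop_eqP x y : x =1 y -> x = y.
Proof. by move=> xy; apply/val_inj/funext. Qed.

Lemma bop_linear x : linear x.
Proof. by case: x => f /= /asboolP[]. Qed.

Lemma bop_continuous x : continuous x.
Proof. by case: x => f /= /asboolP[]. Qed.

Lemma bop_bounded x :
  exists2 M : R, 0 <= M & forall u, rnorm (x u) <= M * rnorm u.
Proof.
have /(bounded_continuous (@bop_linear x))[M xM] := @bop_continuous x.
exists (Num.max M 0); first by rewrite le_max lexx orbT.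
move=> u; rewrite (le_trans (xM u))// ler_wpM2r ?rnorm_ge0//.
by rewrite le_max lexx.
Qed.

Lemma bounded_opP (f : H -> H) (M : R) : linear f ->
  (forall u, rnorm (f u) <= M * rnorm u) -> f \in @bounded_op R H.
Proof.
move=> lf fM; apply/asboolP; split=> //; apply/bounded_continuous => //.
by exists M.
Qed.

Lemma bop0r x : x 0 = 0.
Proof.
apply: (@addrI _ (x 0)); rewrite addr0 -{1}[x 0]scale1r -bop_linear.
by rewrite scaler0 addr0.
Qed.
Lemma bopDr x u v : x (u + v) = x u + x v.
Proof. by rewrite -[u in LHS]scale1r bop_linear scale1r. Qed.
Lemma bopZr x (a : R[i]) u : x (a *: u) = a *: x u.
Proof. by rewrite -[a *: u]addr0 bop_linear bop0r addr0. Qed.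
Lemma bopNr x u : x (- u) = - x u.
Proof. by rewrite -scaleN1r bopZr scaleN1r. Qed.
Lemma bopBr x u v : x (u - v) = x u - x v.
Proof. by rewrite bopDr bopNr. Qed.

Lemma bopDl x y u : (x + y) u = x u + y u.
Proof. by []. Qed.
Lemma bopZl (a : R[i]) x u : (a *: x) u = a *: x u.
Proof. by []. Qed.
Lemma bopNl x u : (- x) u = - x u.
Proof. by []. Qed.
Lemma bopBl x y u : (x - y) u = x u - y u.
Proof. by []. Qed.
Lemma bop0l u : (0 : bop H) u = 0.
Proof. by []. Qed.

Definition opnorm x : R :=
  sup [set rnorm (x u) | u in [set u | rnorm u <= 1]].

Lemma opnorm_has_sup x :
  has_sup [set rnorm (x u) | u in [set u | rnorm u <= 1]].
Proof.
split; first by exists (rnorm (x 0)), 0 => //=; rewrite rnorm0.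
have [M M0 xM] := bop_bounded x; exists M => _ [u /= u1 <-].
by rewrite (le_trans (xM u))// ler_piMr.
Qed.

Lemma opnorm_ge0 x : 0 <= opnorm x.
Proof.
rewrite (le_trans (rnorm_ge0 (x 0)))//; apply: sup_upper_bound.
  exact: opnorm_has_sup.
by exists 0 => //=; rewrite rnorm0.
Qed.

Lemma rnorm_bop x u : rnorm (x u) <= opnorm x * rnorm u.
Proof.
have [->|u0] := eqVneq u 0; first by rewrite bop0r rnorm0 mulr0.
have u1 : 0 < rnorm u.
  rewrite lt_neqAle rnorm_ge0 andbT eq_sym.
  by apply: contra_neq u0; exact: rnorm0_eq0.
rewrite -ler_pdivrMr// mulrC -[X in X * _]gtr0_norm ?invr_gt0//.
rewrite -rnormZr -bopZr; apply: sup_upper_bound; first exact: opnorm_has_sup.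
exists (((rnorm u)^-1)%:C *: u) => //=.
by rewrite rnormZr gtr0_norm ?invr_gt0// mulVf ?gt_eqF.
Qed.

Lemma opnorm_le x (M : R) : 0 <= M ->
  (forall u, rnorm (x u) <= M * rnorm u) -> opnorm x <= M.
Proof.
move=> M0 xM; apply: ge_sup; first by case: (opnorm_has_sup x).
by move=> _ [u /= u1 <-]; rewrite (le_trans (xM u))// ler_piMr.
Qed.

Let normb x : R[i] := (opnorm x)%:C.

Let normbD x y : normb (x + y) <= normb x + normb y.
Proof.
rewrite -rmorphD lecR; apply: opnorm_le; first by rewrite addr_ge0 ?opnorm_ge0.
move=> u; rewrite bopDl (le_trans (ler_rnormD _ _))// mulrDl.
by rewrite lerD ?rnorm_bop.
Qed.

Let opnormZ_le (a : R[i]) x : opnorm (a *: x) <= complex.Re `|a| * opnorm x.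
Proof.
have a0 : 0 <= complex.Re `|a| by rewrite -ler0c RRe_real ?normr_real.
apply: opnorm_le; first by rewrite mulr_ge0 ?opnorm_ge0.
by move=> u; rewrite bopZl rnormZ -mulrA ler_wpM2l ?rnorm_bop.
Qed.

Let normbZ (a : R[i]) x : normb (a *: x) = `|a| * normb x.
Proof.
have [->|a0] := eqVneq a 0.
  rewrite scale0r normr0 mul0r /normb; congr (_%:C); apply/eqP.
  rewrite eq_le opnorm_ge0 andbT; apply: opnorm_le => // u.
  by rewrite bop0l rnorm0 mul0r.
rewrite -[`|a|]RRe_real ?normr_real// -rmorphM; congr (_%:C); apply/eqP.
rewrite eq_le opnormZ_le/=.
have a1 : 0 < complex.Re `|a| by rewrite -ltcR RRe_real ?normr_real// normr_gt0.
rewrite -ler_pdivlMl// -[x in leLHS](scalerK a0).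
rewrite (le_trans (opnormZ_le _ _))// ler_wpM2r ?opnorm_ge0//.
by rewrite -[leLHS]/(Normc.normc a^-1) Normc.normcV.
Qed.

Let normb0_eq0 x : normb x = 0 -> x = 0.
Proof.
move=> /complexI x0; apply: bop_eqP => u; apply: rnorm0_eq0; apply/eqP.
by rewrite eq_le rnorm_ge0 andbT (le_trans (rnorm_bop _ _))// x0 mul0r.
Qed.

HB.instance Definition _ :=
  Lmodule_isNormed.Build R[i] (bop H) normbD normbZ normb0_eq0.

Lemma bop_normE x : `|x| = (opnorm x)%:C.
Proof. by []. Qed.

Lemma bop_rnormE x : rnorm x = opnorm x.
Proof. by []. Qed.
End OperatorNorm.

Section OperatorComplete.
Variables (R : realType) (H : hilbertType R).

Lemma realC_gt0 (e : R[i]) : 0 < e -> exists2 r : R, 0 < r & e = r%:C.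
Proof.
move=> e0; have [r re] : exists r : R, e = r%:C.
  by apply/complex_realP; rewrite realE ltW.
by exists r => //; rewrite -ltcR -re.
Qed.

Lemma ler_small (a k : R) : 0 <= k ->
  (forall e, 0 < e -> a <= e * k) -> a <= 0.
Proof.
move=> k0 h; apply/ler_addgt0Pl => e e0; rewrite addr0.
have k1 : 0 < k + 1 by rewrite ltr_wpDl.
rewrite (le_trans (h (e / (k + 1)) _)) ?divr_gt0//.
by rewrite mulrAC ler_pdivrMr// ler_pM2l// lerDl.
Qed.

Lemma bop_complete (F : set_system (bop H)) :
  ProperFilter F -> cauchy F -> cvg F.
Proof.
move=> FF Fc.
have Fe e : 0 < e -> exists x0 : bop H, F [set x | rnorm (x0 - x) < e].
  move=> e0; have := Fc; move=> /cauchyP /(_ e%:C); rewrite ltcR => /(_ e0).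
  move=> [x0 Fx0]; exists x0; apply: filterS Fx0 => x.
  by rewrite -ball_normE /= rnormE ltcR.
have pt u : cvg ((fun x : bop H => x u) @ F).
  apply: cauchy_cvg; apply/cauchy_exP => e /realC_gt0[r r0 ->].
  have u1 : 0 < rnorm u + 1 by rewrite ltr_wpDl ?rnorm_ge0.
  have [x0 Fx0] := Fe _ (divr_gt0 r0 u1); exists (x0 u).
  rewrite /= !nbhs_simpl /=; apply: filterS Fx0 => x /= x0x.
  rewrite -ball_normE /= rnormE ltcR -bopBl (le_lt_trans (rnorm_bop _ _))//.
  move: x0x; rewrite bop_rnormE ltr_pdivlMr//; apply: le_lt_trans.
  by rewrite ler_wpM2l ?opnorm_ge0 ?lerDl.
pose g u := lim ((fun x : bop H => x u) @ F).
have gF u d : 0 < d -> F [set x : bop H | rnorm (g u - x u) < d].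
  move=> d0; have /cvgrPdist_lt := pt u => /(_ d%:C); rewrite ltcR => /(_ d0).
  by rewrite !nbhs_simpl /=; apply: filterS => x /=; rewrite rnormE ltcR.
have approx e : 0 < e -> exists2 x0 : bop H, F [set x | rnorm (x0 - x) < e] &
    forall u, rnorm (x0 u - g u) <= e * rnorm u.
  move=> e0; have [x0 Fx0] := Fe _ e0; exists x0 => // u.
  apply/ler_addgt0Pl => d d0.
  have [x [/= x0x gx]] := filter_ex (filterI Fx0 (gF u d d0)).
  rewrite -[x0 u](subrK (x u)) -addrA addrC (le_trans (ler_rnormD _ _))//.
  rewrite lerD//; first by rewrite rnormB ltW.
  rewrite -bopBl (le_trans (rnorm_bop _ _))// ler_wpM2r ?rnorm_ge0//.
  by rewrite -bop_rnormE ltW.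
have glin : linear g.
  move=> a u v; apply/eqP; rewrite -subr_eq0; apply/eqP/rnorm0_eq0/eqP.
  rewrite eq_le rnorm_ge0 andbT.
  pose k := rnorm (a *: u + v) + (complex.Re `|a| * rnorm u + rnorm v).
  have a0 : 0 <= complex.Re `|a| by rewrite -ler0c RRe_real ?normr_real.
  apply: (@ler_small _ k); first by rewrite !addr_ge0 ?mulr_ge0 ?rnorm_ge0.
  move=> e e0; have [x0 _ x0g] := approx e e0.
  have -> : g (a *: u + v) - (a *: g u + g v) =
     - (x0 (a *: u + v) - g (a *: u + v)) + (a *: (x0 u - g u) + (x0 v - g v)).
    rewrite opprB bop_linear scalerBr [X in _ = _ + X]addrACA -opprD.
    by rewrite addrA subrK.
  rewrite (le_trans (ler_rnormD _ _))// mulrDr lerD//.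
    by rewrite rnormN x0g.
  rewrite (le_trans (ler_rnormD _ _))// mulrDr lerD//.
  by rewrite rnormZ mulrCA ler_wpM2l.
have gb : g \in @bounded_op R H.
  have [x0 _ x0g] := approx 1 ltr01.
  apply: (@bounded_opP _ _ _ (opnorm x0 + 1)) => // u.
  rewrite -[g u](subrK (x0 u)) addrC (le_trans (ler_rnormD _ _))// mulrDl.
  by rewrite lerD ?rnorm_bop// rnormB x0g.
apply/cvg_ex; exists (Bop gb); apply/cvgrPdist_lt => e /realC_gt0[r r0 ->].
have r2 : 0 < r / 2 by rewrite divr_gt0.
have [x0 Fx0 x0g] := approx _ r2.
apply: filterS Fx0 => x /= x0x; rewrite rnormE ltcR [ltRHS](splitr r).
rewrite -[Bop gb](subrK x0) -addrA (le_lt_trans (ler_rnormD _ _))//.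
by rewrite ler_ltD// rnormB bop_rnormE opnorm_le// ltW.
Qed.

HB.instance Definition _ := Uniform_isComplete.Build (bop H) bop_complete.

End OperatorComplete.

Section OperatorAlgebra.
Variables (R : realType) (H : hilbertType R).
Implicit Types (x y z : bop H) (u v : H).

Fact comp_bounded x y : x \o y \in @bounded_op R H.
Proof.
apply: (@bounded_opP _ _ _ (opnorm x * opnorm y)) => [a u v|u] /=.
  by rewrite !bop_linear.
by rewrite -mulrA (le_trans (rnorm_bop _ _))// ler_wpM2l ?opnorm_ge0 ?rnorm_bop.
Qed.

Definition bop_comp x y : bop H := Bop (comp_bounded x y).

Lemma bop_compE x y u : bop_comp x y u = x (y u).
Proof. by []. Qed.

Lemma opnorm_comp x y : opnorm (bop_comp x y) <= opnorm x * opnorm y.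
Proof.
apply: opnorm_le; first by rewrite mulr_ge0 ?opnorm_ge0.
move=> u; rewrite bop_compE -mulrA (le_trans (rnorm_bop _ _))//.
by rewrite ler_wpM2l ?opnorm_ge0 ?rnorm_bop.
Qed.

Fact adjoint_exists x (v : H) : exists w, forall u, inner (x u) v = inner u w.
Proof.
apply: (@riesz R H (fun u => inner (x u) v) _ (opnorm x * rnorm v)).
- by move=> a u w; rewrite bop_linear innerDl innerZl.
- move=> u; rewrite (le_trans (cauchy_schwarz _ _))// mulrAC.
  by rewrite ler_wpM2r ?rnorm_ge0 ?rnorm_bop.
Qed.

Definition adjoint_fun x v : H := sval (cid (adjoint_exists x v)).

Lemma adjoint_funP x u v : inner (x u) v = inner u (adjoint_fun x v).
Proof. exact: (svalP (cid (adjoint_exists x v))). Qed.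

Fact adjoint_bounded x : adjoint_fun x \in @bounded_op R H.
Proof.
apply: (@bounded_opP _ _ _ (opnorm x)) => [a u v|u].
  apply: inner_ext => w.
  by rewrite -adjoint_funP !(innerDr, innerZr) -!adjoint_funP.
apply: rnorm_inner_le; first by rewrite mulr_ge0 ?opnorm_ge0 ?rnorm_ge0.
move=> v; rewrite Re_innerC -adjoint_funP (le_trans (Re_inner_le _ _))//.
by rewrite [leRHS]mulrAC ler_wpM2r ?rnorm_ge0 ?rnorm_bop.
Qed.

Definition adjoint x : bop H := Bop (adjoint_bounded x).

Lemma adjointP x u v : inner (x u) v = inner u (adjoint x v).
Proof. exact: adjoint_funP. Qed.

Lemma adjoint_uniq x y :
  (forall u v, inner (x u) v = inner u (y v)) -> adjoint x = y.
Proof.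
by move=> xy; apply: bop_eqP => v; apply: inner_ext => u; rewrite -adjointP xy.
Qed.

Lemma adjointK : involutive adjoint.
Proof.
move=> x; apply: adjoint_uniq => u v.
by rewrite innerC -adjointP -innerC.
Qed.

Lemma adjoint_comp x y :
  adjoint (bop_comp x y) = bop_comp (adjoint y) (adjoint x).
Proof.
by apply: adjoint_uniq => u v; rewrite !bop_compE !adjointP.
Qed.

Lemma adjoint_antilinear (a : R[i]) x y :
  adjoint (a *: x + y) = a^* *: adjoint x + adjoint y.
Proof.
apply: adjoint_uniq => u v.
rewrite !bopDl !bopZl innerDl innerDr innerZl innerZr !adjointP.
by congr (_ * _ + _); exact/esym/conjCK.
Qed.

Let opnorm_adjoint_le x : opnorm (adjoint x) <= opnorm x.
Proof.
apply: opnorm_le => [|u]; first exact: opnorm_ge0.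
apply: rnorm_inner_le; first by rewrite mulr_ge0 ?opnorm_ge0 ?rnorm_ge0.
move=> v; rewrite Re_innerC -adjointP (le_trans (Re_inner_le _ _))//.
by rewrite [leRHS]mulrAC ler_wpM2r ?rnorm_ge0 ?rnorm_bop.
Qed.

Lemma opnorm_adjoint x : opnorm (adjoint x) = opnorm x.
Proof.
apply/eqP; rewrite eq_le opnorm_adjoint_le/=.
by rewrite -{1}[x]adjointK opnorm_adjoint_le.
Qed.

Lemma opnorm_star x : opnorm (bop_comp (adjoint x) x) = opnorm x ^+ 2.
Proof.
apply/eqP; rewrite eq_le (le_trans (opnorm_comp _ _)) ?opnorm_adjoint//=.
set N := opnorm (bop_comp _ _).
have N0 : 0 <= N by exact: opnorm_ge0.
rewrite -(sqr_sqrtr N0) ler_pXn2r// ?nnegrE ?opnorm_ge0 ?sqrtr_ge0//.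
apply: opnorm_le => [|u]; first exact: sqrtr_ge0.
rewrite -(@ler_pXn2r _ 2)// ?nnegrE ?mulr_ge0 ?sqrtr_ge0 ?rnorm_ge0//.
rewrite exprMn sqr_sqrtr//.
have -> : rnorm (x u) ^+ 2 = complex.Re (inner u (bop_comp (adjoint x) x u)).
  by rewrite bop_compE -adjointP inner_rnorm.
rewrite (le_trans (Re_inner_le _ _))// expr2 mulrA mulrC.
by rewrite ler_wpM2r ?rnorm_ge0 ?rnorm_bop.
Qed.

Let compA : associative bop_comp.
Proof. by move=> x y z; apply: bop_eqP. Qed.

Let comp_linearl y : linear (bop_comp^~ y).
Proof. by move=> a x z; apply: bop_eqP. Qed.

Let comp_linearr x : linear (bop_comp x).
Proof. by move=> a y z; apply: bop_eqP => u; rewrite bop_compE bop_linear. Qed.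

Let bop_normM x y : `|bop_comp x y| <= `|x| * `|y|.
Proof. by rewrite !bop_normE -rmorphM lecR opnorm_comp. Qed.

Let bop_norm_star x : `|bop_comp (adjoint x) x| = `|x| ^+ 2.
Proof. by rewrite !bop_normE opnorm_star rmorphXn. Qed.

HB.instance Definition _ := isCStarAlgebra.Build R (bop H)
  compA comp_linearl comp_linearr bop_normM adjoint_antilinear adjointK
  adjoint_comp bop_norm_star.

End OperatorAlgebra.

Section Triples.
Variables (R : realType) (A : cstarAlgType R).
Implicit Types a b c : A.

Definition tro_prod a b c : A := cmul (cmul a (cstar b)) c.

Definition jordan_prod a b c : A :=
  (2^-1 : R[i]) *: (tro_prod a b c + tro_prod c b a).

Definition is_subspace (E : set A) :=
  E 0 /\ forall (k : R[i]) a b, E a -> E b -> E (k *: a + b).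

Definition is_TRO (T : set A) :=
  [/\ is_subspace T, closed T &
      forall a b c, T a -> T b -> T c -> T (tro_prod a b c)].

(* A JC*-triple is presented by a realisation: a norm closed subspace E of a
   C*-algebra closed under the triple product. The C*-algebra is itself a TRO
   and every TRO lies in a C*-algebra, so that asking for the ambient space to
   be a C*-algebra or a TRO amounts to the same. *)
Definition is_JC_triple (E : set A) :=
  [/\ is_subspace E, closed E &
      forall a b c, E a -> E b -> E c -> E (jordan_prod a b c)].

Record TRO := MkTRO { tro_set :> set A ; TROP : is_TRO tro_set }.

Record JC_triple := MkJC_triple {
  JC_set :> set A ; JC_tripleP : is_JC_triple JC_set }.

Fact full_is_TRO : is_TRO setT.
Proof. by split=> //; exact: closedT. Qed.

Definition full_TRO := MkTRO full_is_TRO.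

(* a_0 a_1^* a_2 ... a_{2k-1}^* a_{2k} *)
Fixpoint alt_prod (a : nat -> A) (k : nat) : A :=
  if k is j.+1 then tro_prod (alt_prod a j) (a j.*2.+1) (a j.*2.+2) else a 0%N.

Definition reversible (E : set A) :=
  forall (k : nat) (a : nat -> A), (1 <= k)%N ->
    (forall i, (i <= k.*2)%N -> E (a i)) ->
    E (alt_prod a k + alt_prod (fun i => a (k.*2 - i)%N) k).

End Triples.

Section Homomorphisms.
Variables (R : realType) (A B : cstarAlgType R).

(* Maps out of a subspace E of A are given by functions on A, of which only the
   restriction to E matters: no condition is put on the values outside E, and
   uniqueness below is uniqueness on the subspace. *)
Definition linear_on (E : set A) (f : A -> B) :=
  forall (k : R[i]) a b, E a -> E b -> f (k *: a + b) = k *: f a + f b.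

Definition triple_hom (E : set A) (T : set B) (f : A -> B) :=
  [/\ linear_on E f, (forall a, E a -> T (f a)) &
      forall a b c, E a -> E b -> E c ->
        f (jordan_prod a b c) = jordan_prod (f a) (f b) (f c)].

Definition TRO_hom (S : set A) (T : set B) (f : A -> B) :=
  [/\ linear_on S f, (forall a, S a -> T (f a)) &
      forall a b c, S a -> S b -> S c ->
        f (tro_prod a b c) = tro_prod (f a) (f b) (f c)].

End Homomorphisms.

(* smallest is_TRO X is the TRO generated by X. *)
Definition is_universal_TRO (R : realType) (A : cstarAlgType R)
    (E : JC_triple A) (B : cstarAlgType R) (T : TRO B) (alpha : A -> B) :=
  [/\ triple_hom E T alpha, set_inj E alpha,
      smallest (@is_TRO R B) (alpha @` E) = T &
      forall (D : cstarAlgType R) (S : TRO D) (pi : A -> D),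
        triple_hom E S pi ->
        exists f : B -> D, [/\ TRO_hom T S f,
          {in JC_set E, f \o alpha =1 pi} &
          forall g : B -> D, TRO_hom T S g -> {in JC_set E, g \o alpha =1 pi} ->
            {in tro_set T, g =1 f}]].

(* Universal TROs are unique up to isomorphism, so any of them may be tested;
   the first clause rules out vacuity. *)
Definition universally_reversible (R : realType) (A : cstarAlgType R)
    (E : JC_triple A) :=
  (exists (B : cstarAlgType R) (T : TRO B) (alpha : A -> B),
     is_universal_TRO E T alpha) /\
  (forall (B : cstarAlgType R) (T : TRO B) (alpha : A -> B),
     is_universal_TRO E T alpha -> reversible (alpha @` E)).

Section Hilbert.
Variables (R : realType) (H : hilbertType R).

(* orthonormal and total *)
Definition orthonormal_basis (B : set H) :=
  [/\ forall b, B b -> inner b b = 1,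
      forall b c, B b -> B c -> b <> c -> inner b c = 0 &
      forall x, (forall b, B b -> inner x b = 0) -> x = 0].

Record conjugation := Conjugation {
  conjH :> H -> H ;
  conjH_antilinear : forall (k : R[i]) x y,
    conjH (k *: x + y) = k^* *: conjH x + conjH y ;
  conjH_isometry : forall x, `|conjH x| = `|x| ;
  conjHK : involutive conjH }.

Variable J : conjugation.
Implicit Types (x y z : bop H) (u v : H).

Lemma rnorm_conjH u : rnorm (J u) = rnorm u.
Proof. by rewrite /rnorm conjH_isometry. Qed.

Fact transpose_bounded x : (fun u => J (adjoint x (J u))) \in @bounded_op R H.
Proof.
apply: (@bounded_opP _ _ _ (opnorm (adjoint x))) => [a u v|u].
  by rewrite conjH_antilinear bop_linear conjH_antilinear conjCK.
by rewrite rnorm_conjH -(rnorm_conjH u) rnorm_bop.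
Qed.

Definition transpose x : bop H := Bop (transpose_bounded x).

Lemma transposeE x u : transpose x u = J (adjoint x (J u)).
Proof. by []. Qed.

Lemma conjHD u v : J (u + v) = J u + J v.
Proof. by rewrite -[u in LHS]scale1r conjH_antilinear conjC1 scale1r. Qed.

Lemma conjH0 : J 0 = 0.
Proof. by apply: (@addrI _ (J 0)); rewrite -conjHD !addr0. Qed.

Lemma conjHZ (a : R[i]) u : J (a *: u) = a^* *: J u.
Proof. by rewrite -[a *: u]addr0 conjH_antilinear conjH0 addr0. Qed.

Lemma Re_inner_conjH u v :
  complex.Re (inner (J u) (J v)) = complex.Re (inner u v).
Proof.
have := rnormD_sqr u v; have := rnormD_sqr (J u) (J v).
rewrite -conjHD !rnorm_conjH => -> /addrI.
by apply: mulfI.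
Qed.

Lemma inner_conjH u v : inner (J u) (J v) = inner v u.
Proof.
have h := Re_inner_conjH u v; have := Re_inner_conjH ('i%C *: u) v.
rewrite conjHZ !innerZl (innerC v u).
move: h; case: (inner (J u) (J v)) => a b; case: (inner u v) => c d /= ->.
by move=> h; rewrite -[RHS]/(c +i* - d); congr (_ +i* _); move: h; lra.
Qed.

Lemma transpose_antimul x y :
  transpose (bop_comp x y) = bop_comp (transpose y) (transpose x).
Proof.
apply: bop_eqP => u.
by rewrite bop_compE !transposeE adjoint_comp bop_compE conjHK.
Qed.

Lemma transpose_linear (a : R[i]) x y :
  transpose (a *: x + y) = a *: transpose x + transpose y.
Proof.
apply: bop_eqP => u; rewrite bopDl bopZl !transposeE adjoint_antilinear.
by rewrite bopDl bopZl conjH_antilinear conjCK.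
Qed.

Lemma transposeB x y : transpose (x - y) = transpose x - transpose y.
Proof. by rewrite addrC -scaleN1r transpose_linear scaleN1r addrC. Qed.

Lemma transpose0 : transpose 0 = 0.
Proof.
apply: (@addrI _ (transpose 0)).
by rewrite -{1}[transpose 0]scale1r -transpose_linear scale1r !addr0.
Qed.

Lemma transpose_adjoint x : transpose (adjoint x) = adjoint (transpose x).
Proof.
apply/esym/adjoint_uniq => u v; rewrite !transposeE adjointK.
rewrite -[X in inner _ X = _](conjHK J) inner_conjH.
rewrite -[X in _ = inner X _](conjHK J) inner_conjH.
by rewrite adjointP.
Qed.

Lemma opnorm_transpose_le x : opnorm (transpose x) <= opnorm x.
Proof.
apply: opnorm_le => [|u]; first exact: opnorm_ge0.
rewrite transposeE rnorm_conjH (le_trans (rnorm_bop _ _))//.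
by rewrite opnorm_adjoint rnorm_conjH.
Qed.

Definition sym_ops : set (bop H) := [set x | transpose x = x].

Definition skew_ops : set (bop H) := [set x | transpose x = - x].

Lemma adjointZ (a : R[i]) x : adjoint (a *: x) = a^* *: adjoint x.
Proof.
apply: adjoint_uniq => u v.
by rewrite !bopZl innerZl innerZr conjCK adjointP.
Qed.

Lemma transpose_eig_closed (e : R[i]) : `|e| = 1 ->
  closed [set x : bop H | transpose x = e *: x].
Proof.
move=> e1; apply: closed_rnorm => x h; apply/eqP; rewrite -subr_eq0.
apply/eqP/rnorm0_eq0/eqP; rewrite eq_le rnorm_ge0 andbT.
apply: (@ler_small _ _ 2) => // d /h[y /= ye xy].
have -> : transpose x - e *: x = transpose (x - y) - e *: (x - y).
  by rewrite transposeB ye scalerBr opprB addrA subrK.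
rewrite mulrC mulr_natl mulr2n (le_trans (ler_rnormD _ _))// lerD//.
  by rewrite (le_trans (opnorm_transpose_le _))// ltW.
by rewrite rnormN rnormZ e1 mul1r ltW.
Qed.

Lemma transpose_eig_JC (e : R[i]) : e = 1 \/ e = -1 ->
  is_JC_triple [set x : bop H | transpose x = e *: x].
Proof.
move=> e1; have ee : e * e = 1 by case: e1 => ->; rewrite ?mulrNN mul1r.
have ec : e^* = e by case: e1 => ->; rewrite ?rmorphN rmorph1.
have tP a b c : transpose a = e *: a -> transpose b = e *: b ->
    transpose c = e *: c -> transpose (tro_prod a b c) = e *: tro_prod c b a.
  move=> ta tb tc; rewrite /tro_prod /cmul /cstar /=.
  rewrite !transpose_antimul transpose_adjoint ta tb tc.
  apply: bop_eqP => u; rewrite !(bop_compE, bopZl).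
  by rewrite adjointZ ec !bopZl !bopZr !scalerA ee mul1r.
split; last 2 first.
- by apply: transpose_eig_closed; case: e1 => ->; rewrite ?normrN normr1.
- move=> a b c /= ta tb tc; rewrite /jordan_prod.
  rewrite -[X in transpose X]addr0 transpose_linear transpose0 addr0.
  rewrite -[tro_prod a b c]scale1r transpose_linear scale1r !tP//.
  by rewrite scale1r -scalerDr !scalerA [_ * e]mulrC [in RHS]addrC.
split=> [|k a b /= ta tb]; first by rewrite /= transpose0 scaler0.
by rewrite transpose_linear ta tb scalerDr !scalerA mulrC.
Qed.

Fact sym_ops_JC : is_JC_triple sym_ops.
Proof.
rewrite (_ : sym_ops = [set x | transpose x = 1 *: x]).
  by apply: transpose_eig_JC; left.
by apply/seteqP; split=> x; rewrite /sym_ops /= scale1r.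
Qed.

Fact skew_ops_JC : is_JC_triple skew_ops.
Proof.
rewrite (_ : skew_ops = [set x | transpose x = -1 *: x]).
  by apply: transpose_eig_JC; right.
by apply/seteqP; split=> x; rewrite /skew_ops /= scaleN1r.
Qed.

Definition sym_triple := MkJC_triple sym_ops_JC.
Definition skew_triple := MkJC_triple skew_ops_JC.

End Hilbert.

(* Main.v *)
Require Import Defs.
From mathcomp Require Import all_boot all_order all_algebra complex finmap.
From mathcomp Require Import all_classical all_reals topology normedtype.
Local Open Scope classical_set_scope.
Local Open Scope card_scope.

(* A real orthonormal basis of [H], arranged in [n] rows of equal length, yields
   matrix units [e i j] in B(H) with transpose [e j i]: if dim H is finite each
   row is a single vector, otherwise [n = 5]. With [eps = 1] for S_n and
   [eps = -1] for A_n, write [psi y] for the image under a triple homomorphism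
   [pi] of [y + eps *: t y], and [U i j] for [psi (e i j)]. If [n >= 5], cutting
   [psi y], for [y] in the corner (i, k), by the left support of [U i j] gives an
   element [off i k y] which does not depend on [j], and these elements multiply
   like the off-diagonal entries of matrices. This coordinatizes the TRO spanned
   by the image of [pi], hence extends [pi] to a TRO homomorphism on B(H). Every
   operator is a finite sum of triple products of elements of the triple, hence
   uniqueness; no continuity is involved. Transposition reverses the alternating
   products, so that the triple is reversible in B(H). *)

(** The obstacle is that [pi] controls only the symmetric sums $xy^*z + zy^*x$, whereas a TRO
    homomorphism has to know each summand. Multiplying such a sum by the support of a tripotent
    [U i j] separates the summands as soon as this support fixes one and kills the other; four
    distinct indices achieve this, and a fifth makes the result independent of the auxiliary index.
    Hence the bound on A_n, and five rows in infinite dimension. The small S_n escape because their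
    diagonal matrix units lie in the triple and cut out single entries, provided that the corners
    are scalar. A finite number of rows keeps topology out: the [e i i] add up to the identity in a
    finite sum, and infinite multiplicity hides in the corners, which the generic argument never
    inspects. For [eps = -1] the map [psi] vanishes on every [e i i], so the coordinatization starts
    from an off-diagonal corner (a, b). Since different algebras act on the two sides of a TRO, it
    uses separate families of left and right matrix units. *)

Ltac distinct :=
  repeat match goal with
  | H : is_true (_ \notin _ :: _) |- _ => rewrite in_cons negb_or in H
  | H : is_true (uniq (_ :: _)) |- _ => rewrite cons_uniq in H
  | H : is_true (_ && _) |- _ => case/andP: H; intros
  end;
  rewrite ?cons_uniq ?in_cons ?negb_or;
  repeat (apply/andP; split);
  solve [assumption | rewrite eq_sym; assumption | done].

(** * Arithmetic of linear maps and of C*-algebras *)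

Section LinearMaps.
Set Implicit Arguments.
Unset Strict Implicit.
Variables (K : pzRingType) (V W : lmodType K) (f : V -> W).
Local Open Scope ring_scope.
Import GRing.Theory.
Hypothesis f_linear : linear f.

Lemma linear_funD x y : f (x + y) = f x + f y.
Proof. by rewrite -[x in LHS]scale1r f_linear scale1r. Qed.
Lemma linear_fun0 : f 0 = 0.
Proof. by apply: (@addrI _ (f 0)); rewrite -linear_funD !addr0. Qed.
Lemma linear_funZ k x : f (k *: x) = k *: f x.
Proof. by rewrite -[k *: x]addr0 f_linear linear_fun0 addr0. Qed.

End LinearMaps.

Section CStarAlgebraTheory.
Set Implicit Arguments.
Unset Strict Implicit.
Variables (R : realType) (A : cstarAlgType R).
Implicit Types (a b c x y : A) (k : R[i]).
Local Open Scope ring_scope.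
Import GRing.Theory Num.Theory.

Lemma cmulDl a b c : cmul (a + b) c = cmul a c + cmul b c.
Proof. exact: (linear_funD (cmul_linearl c)). Qed.
Lemma cmulDr a b c : cmul c (a + b) = cmul c a + cmul c b.
Proof. exact: (linear_funD (cmul_linearr c)). Qed.
Lemma cmul0l c : cmul 0 c = 0.
Proof. exact: (linear_fun0 (cmul_linearl c)). Qed.
Lemma cmul0r c : cmul c 0 = 0.
Proof. exact: (linear_fun0 (cmul_linearr c)). Qed.
Lemma cmulZl k a c : cmul (k *: a) c = k *: cmul a c.
Proof. exact: (linear_funZ (cmul_linearl c)). Qed.
Lemma cmulZr k a c : cmul c (k *: a) = k *: cmul c a.
Proof. exact: (linear_funZ (cmul_linearr c)). Qed.
Lemma cmul_suml (I : Type) (r : seq I) (P : pred I) (F : I -> A) c :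
  cmul (\sum_(i <- r | P i) F i) c = \sum_(i <- r | P i) cmul (F i) c.
Proof.
by apply: (big_morph (fun x => cmul x c)) => [x y|]; rewrite ?cmulDl ?cmul0l.
Qed.
Lemma cmul_sumr (I : Type) (r : seq I) (P : pred I) (F : I -> A) c :
  cmul c (\sum_(i <- r | P i) F i) = \sum_(i <- r | P i) cmul c (F i).
Proof.
by apply: (big_morph (cmul c)) => [x y|]; rewrite ?cmulDr ?cmul0r.
Qed.

Lemma cstarD a b : cstar (a + b) = cstar a + cstar b.
Proof. by rewrite -[a in LHS]scale1r cstar_antilinear rmorph1 scale1r. Qed.
Lemma cstar0 : cstar (0 : A) = 0.
Proof. by apply: (@addrI _ (cstar 0)); rewrite -cstarD !addr0. Qed.
Lemma cstarZ k a : cstar (k *: a) = k^* *: cstar a.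
Proof. by rewrite -[k *: a]addr0 cstar_antilinear cstar0 addr0. Qed.
Lemma cstar_sum (I : Type) (r : seq I) (P : pred I) (F : I -> A) :
  cstar (\sum_(i <- r | P i) F i) = \sum_(i <- r | P i) cstar (F i).
Proof.
by apply: (big_morph (@cstar R A)) => [x y|]; rewrite ?cstarD ?cstar0.
Qed.

Lemma jordan_prodE a b c :
  tro_prod a b c + tro_prod c b a = (2 : R[i]) *: jordan_prod a b c.
Proof. by rewrite /jordan_prod scalerA divff ?scale1r// pnatr_eq0. Qed.

End CStarAlgebraTheory.

(** * Extending a map from one corner to the whole matrix algebra *)

Section Coordinatization.
Set Implicit Arguments.
Unset Strict Implicit.
Variables (R : realType) (A D : cstarAlgType R).
Local Open Scope ring_scope.
Import GRing.Theory Num.Theory.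
Local Notation "a ** b" := (cmul a b) (at level 40, left associativity).
Local Notation "a ^#" := (cstar a) (at level 2, format "a ^#").

(** The last clause makes the diagonal units add up to an identity; it is phrased by left
    multiplication because the algebra need not be unital, and adjoints give the right-hand
    version. *)
Definition matrix_units n (e : 'I_n -> 'I_n -> A) :=
  [/\ forall i j k l, e i j ** e k l = if j == k then e i l else 0,
      forall i j, (e i j)^# = e j i &
      forall x, \sum_i e i i ** x = x].

Variables (n : nat) (e : 'I_n -> 'I_n -> A).
Hypothesis emu : matrix_units e.
Implicit Types (i j k l : 'I_n) (x y z : A).

Lemma muM i j k l : e i j ** e k l = if j == k then e i l else 0.
Proof. by case: emu. Qed.
Lemma muMx i j k : e i j ** e j k = e i k.
Proof. by rewrite muM eqxx. Qed.
Lemma muM0 i j k l : j != k -> e i j ** e k l = 0.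
Proof. by rewrite muM => /negPf ->. Qed.
Lemma mu_star i j : (e i j)^# = e j i.
Proof. by case: emu. Qed.
Lemma mu_suml x : \sum_i e i i ** x = x.
Proof. by case: emu. Qed.
Lemma mu_sumr x : \sum_i x ** e i i = x.
Proof.
apply: (can_inj (@cstarK R A)); rewrite cstar_sum -[RHS]mu_suml.
by apply: eq_bigr => i _; rewrite cstarM mu_star.
Qed.
Lemma mu_sum2 x : \sum_i \sum_j e i i ** x ** e j j = x.
Proof.
by rewrite -[RHS]mu_suml; apply: eq_bigr => i _; rewrite mu_sumr.
Qed.

(* [L i] and [M j] act on the image of [Theta] as the matrix units [e i a] on
   the left and [e b j] on the right would. *)
Variables (a b : 'I_n) (Theta : A -> D) (L M : 'I_n -> D).
Hypothesis ThetaP : linear Theta.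
Hypothesis LTheta : forall i k x, x = e a a ** x ** e b b ->
  (L i)^# ** L k ** Theta x = if i == k then Theta x else 0.
Hypothesis ThetaM : forall j k x, x = e a a ** x ** e b b ->
  Theta x ** M j ** (M k)^# = if j == k then Theta x else 0.
Hypothesis Theta_tro : forall x y z, x = e a a ** x ** e b b ->
  y = e a a ** y ** e b b -> z = e a a ** z ** e b b ->
  Theta x ** (Theta y)^# ** Theta z = Theta (x ** y^# ** z).

Let Theta0 : Theta 0 = 0 := linear_fun0 ThetaP.
Let ThetaD x y : Theta (x + y) = Theta x + Theta y := linear_funD ThetaP x y.
Let Theta_sum (I : Type) (r : seq I) (F : I -> A) :
  Theta (\sum_(i <- r) F i) = \sum_(i <- r) Theta (F i).
Proof. by apply: (big_morph Theta) => [x y|]; rewrite ?ThetaD ?Theta0. Qed.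

Definition coord_map x : D :=
  \sum_i \sum_j L i ** Theta (e a i ** x ** e j b) ** M j.

Lemma coord_map_linear : linear coord_map.
Proof.
move=> k x y; rewrite /coord_map scaler_sumr -big_split; apply: eq_bigr => i _.
rewrite scaler_sumr -big_split; apply: eq_bigr => j _ /=.
by rewrite cmul_linearr cmul_linearl ThetaP cmul_linearr cmul_linearl.
Qed.

Let entry i j x : e a i ** x ** e j b = e a a ** (e a i ** x ** e j b) ** e b b.
Proof. by rewrite !cmulA muMx -!cmulA muMx !cmulA. Qed.

(** On the right-hand side the [M] factors meet between x and y and contract to one column index,
    the [L] factors meet between y and z and contract to one row index; the two sums that remain
    reassemble y from its blocks [e k k ** y ** e j j]. *)
Lemma coord_map_tro x y z :
  coord_map (x ** y^# ** z) = coord_map x ** (coord_map y)^# ** coord_map z.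
Proof.
pose X i j w := Theta (e a i ** w ** e j b).
pose rho i w := \sum_j X i j w ** M j.
have mapE w : coord_map w = \sum_i L i ** rho i w.
  by apply: eq_bigr => i _; rewrite cmul_sumr; apply: eq_bigr => j _; rewrite cmulA.
have Lmap k w : (L k)^# ** coord_map w = rho k w.
  rewrite mapE cmul_sumr (bigD1 k)//= [X in _ + X]big1 ?addr0 => [|m /negPf mk].
    rewrite cmulA cmul_sumr; apply: eq_bigr => p _.
    by rewrite cmulA LTheta -?entry// eqxx.
  rewrite cmulA cmul_sumr big1// => p _.
  by rewrite cmulA LTheta -?entry// eq_sym mk cmul0l.
have rhorho i k w w' : rho i w ** (rho k w')^# = \sum_j X i j w ** (X k j w')^#.
  rewrite cmul_suml; apply: eq_bigr => j _.
  rewrite cstar_sum cmul_sumr (bigD1 j)//= [X in _ + X]big1 ?addr0 => [|m /negPf mj].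
    by rewrite cstarM cmulA ThetaM -?entry// eqxx.
  by rewrite cstarM cmulA ThetaM -?entry// eq_sym mj cmul0l.
rewrite [in RHS]mapE cmul_suml cmul_suml mapE; apply: eq_bigr => i _.
rewrite mapE cstar_sum cmul_sumr cmul_suml.
under eq_bigr => k _ do rewrite cstarM cmulA -cmulA Lmap -[L i ** _ ** _]cmulA -cmulA.
rewrite -cmul_sumr; congr (_ ** _).
transitivity (\sum_k \sum_j \sum_p X i j x ** (X k j y)^# ** X k p z ** M p); last first.
  apply: eq_bigr => k _; rewrite rhorho cmul_suml; apply: eq_bigr => j _.
  by rewrite cmul_sumr; apply: eq_bigr => p _; rewrite !cmulA.
rewrite (eq_bigr _ (fun _ _ => exchange_big _ _ _ _ _ _)) exchange_big.
apply: eq_bigr => p _ /=; under eq_bigr => k _ do rewrite -cmul_suml.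
rewrite -cmul_suml; congr (_ ** _).
rewrite /X -{1}[y]mu_sum2 cstar_sum cmul_sumr cmul_suml cmul_sumr cmul_suml Theta_sum.
apply: eq_bigr => k _.
rewrite cstar_sum cmul_sumr cmul_suml cmul_sumr cmul_suml Theta_sum.
apply: eq_bigr => j _; rewrite Theta_tro -?entry//; congr Theta.
rewrite !cstarM !mu_star !cmulA.
rewrite -[_ ** e j b ** e b j]cmulA muMx.
by rewrite -[_ ** e k a ** e a k]cmulA muMx.
Qed.

Lemma coord_map_corner i j x : x = e i i ** x ** e j j ->
  coord_map x = L i ** Theta (e a i ** x ** e j b) ** M j.
Proof.
move=> xE; rewrite /coord_map (bigD1 i)//= [X in _ + X]big1 ?addr0 => [|k ki].
  rewrite (bigD1 j)//= [X in _ + X]big1 ?addr0// => k kj.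
  have jk : j != k by rewrite eq_sym.
  by rewrite xE -!cmulA (muM0 _ _ jk) !cmul0r Theta0 cmul0l cmul0r.
rewrite big1// => l _; rewrite xE !cmulA (muM0 _ _ ki) !cmul0l.
by rewrite Theta0 cmul0r cmul0l.
Qed.

End Coordinatization.

(** * Peirce projections of a tripotent *)

Section Peirce.
Set Implicit Arguments.
Unset Strict Implicit.
Variables (R : realType) (D : cstarAlgType R) (u : D).
Local Open Scope ring_scope.
Import GRing.Theory Num.Theory.
Local Notation "a ** b" := (cmul a b) (at level 40, left associativity).
Local Notation "a ^#" := (cstar a) (at level 2, format "a ^#").

Lemma double_inj (x y : D) : x + x = y + y -> x = y.
Proof.
have two : (2 : R[i]) != 0 by rewrite pnatr_eq0.
by move=> xy; apply: (scalerI two); rewrite !scaler_nat 2![_ *+ 2]mulr2n.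
Qed.

Hypothesis uu : u ** u^# ** u = u.

Lemma left_supp x : u ** u^# ** (u ** u^# ** x) = u ** u^# ** x.
Proof. by rewrite !cmulA uu. Qed.
Lemma right_supp x : x ** u^# ** u ** u^# ** u = x ** u^# ** u.
Proof. by rewrite -[_ ** u ** u^#]cmulA -cmulA -[x ** _ ** _]cmulA uu cmulA. Qed.

(** With $P = uu^*$ and $Q = u^*u$, multiplying $Px + xQ = 0$ by P on the left and by Q on the right
    gives $Px = -PxQ = xQ$, so $2Px = 0$. A Jordan identity thus yields one-sided ones. *)
Lemma peirce0 x : u ** u^# ** x + x ** u^# ** u = 0 ->
  u ** u^# ** x = 0 /\ x ** u^# ** u = 0.
Proof.
move=> h; have hl : u ** u^# ** x + u ** u^# ** x ** u^# ** u = 0.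
  by have := congr1 (cmul (u ** u^#)) h; rewrite cmulDr left_supp cmul0r !cmulA.
have hr : u ** u^# ** x ** u^# ** u + x ** u^# ** u = 0.
  have := congr1 (fun z => z ** u^# ** u) h.
  by rewrite /= !cmulDl right_supp !cmul0l.
have e1 : u ** u^# ** x = x ** u^# ** u.
  by apply: (addIr (u ** u^# ** x ** u^# ** u)); rewrite hl addrC hr.
by move: h; rewrite e1 -[RHS]addr0 => /double_inj ->.
Qed.

Lemma peirce2 x : u ** u^# ** x + x ** u^# ** u = x + x ->
  u ** u^# ** x = x /\ x ** u^# ** u = x.
Proof.
move=> h; have hl : u ** u^# ** x + u ** u^# ** x ** u^# ** u =
    u ** u^# ** x + u ** u^# ** x.
  by have := congr1 (cmul (u ** u^#)) h; rewrite !cmulDr left_supp !cmulA.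
have hr : u ** u^# ** x ** u^# ** u + x ** u^# ** u =
    x ** u^# ** u + x ** u^# ** u.
  have := congr1 (fun z => z ** u^# ** u) h.
  by rewrite /= !cmulDl right_supp.
have e1 : u ** u^# ** x = x ** u^# ** u.
  by rewrite -(addIr _ hr); exact/esym/(addrI _ hl).
by move: h; rewrite e1 => /double_inj ->.
Qed.

End Peirce.

(** * Triple homomorphisms on an eigenspace of a transposition *)

Section Extension.
Set Implicit Arguments.
Unset Strict Implicit.
Variables (R : realType) (A D : cstarAlgType R).
Local Open Scope ring_scope.
Import GRing.Theory Num.Theory.
Local Notation "a ** b" := (cmul a b) (at level 40, left associativity).
Local Notation "a ^#" := (cstar a) (at level 2, format "a ^#").

Variables (n : nat) (e : 'I_n -> 'I_n -> A).
Hypothesis emu : matrix_units e.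
Variables (t : A -> A) (eps : R[i]) (pi : A -> D).
Hypothesis t_linear : linear t.
Hypothesis tK : involutive t.
Hypothesis tM : forall x y, t (x ** y) = t y ** t x.
Hypothesis t_star : forall x, t x^# = (t x)^#.
Hypothesis te : forall i j, t (e i j) = e j i.
Hypothesis eps1 : eps = 1 \/ eps = -1.
Let E : set A := fun x => t x = eps *: x.
Hypothesis pi_linear : linear_on E pi.
Hypothesis pi_jordan : forall x y z, E x -> E y -> E z ->
  pi (jordan_prod x y z) = jordan_prod (pi x) (pi y) (pi z).
Implicit Types (i j k l m p : 'I_n) (x y z : A).

Lemma eps_sqr : eps * eps = 1.
Proof. by case: eps1 => ->; rewrite ?mulrNN mulr1. Qed.
Lemma eps_conj : eps^* = eps.
Proof. by case: eps1 => ->; rewrite ?rmorphN rmorph1. Qed.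
Lemma epsZK (V : lmodType R[i]) (v : V) : eps *: (eps *: v) = v.
Proof. by rewrite scalerA eps_sqr scale1r. Qed.

Let t0 : t 0 = 0 := linear_fun0 t_linear.
Let tD x y : t (x + y) = t x + t y := linear_funD t_linear x y.
Let tZ (k : R[i]) x : t (k *: x) = k *: t x := linear_funZ t_linear k x.

Let E0 : E 0.
Proof. by rewrite /E t0 scaler0. Qed.
Let EZ (k : R[i]) x : E x -> E (k *: x).
Proof. by rewrite /E => Ex; rewrite tZ Ex !scalerA mulrC. Qed.

Lemma t_tro x y z : E x -> E y -> E z ->
  t (x ** y^# ** z) = eps *: (z ** y^# ** x).
Proof.
rewrite /E => Ex Ey Ez; rewrite !tM t_star Ex Ey Ez cstarZ eps_conj.
by rewrite !(cmulZl, cmulZr) epsZK !cmulA.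
Qed.

Lemma E_tro x y z : E x -> E y -> E z -> E (x ** y^# ** z + z ** y^# ** x).
Proof.
by move=> Ex Ey Ez; rewrite /E tD !t_tro// scalerDr addrC.
Qed.

Lemma piD x y : E x -> E y -> pi (x + y) = pi x + pi y.
Proof. by move=> Ex Ey; rewrite -[x in LHS]scale1r pi_linear// scale1r. Qed.
Lemma pi0 : pi 0 = 0.
Proof. by apply: (@addrI _ (pi 0)); rewrite -piD ?addr0//; exact: E0. Qed.
Lemma piZ (k : R[i]) x : E x -> pi (k *: x) = k *: pi x.
Proof.
by move=> Ex; rewrite -[k *: x]addr0 pi_linear// ?pi0 ?addr0//; exact: E0.
Qed.

Lemma pi_tro x y z : E x -> E y -> E z ->
  pi (x ** y^# ** z + z ** y^# ** x) =
  pi x ** (pi y)^# ** pi z + pi z ** (pi y)^# ** pi x.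
Proof.
move=> Ex Ey Ez; rewrite -/(tro_prod x y z) -/(tro_prod z y x).
rewrite jordan_prodE piZ ?pi_jordan -?jordan_prodE//.
by rewrite /jordan_prod; apply/EZ/E_tro.
Qed.

(** Twice the projection onto [E]. Without the factor 1/2, [symz (e i j)] is a partial isometry for
    i != j. *)
Definition symz y := y + eps *: t y.
Definition psi y := pi (symz y).

Lemma symzE y : E (symz y).
Proof. by rewrite /E /symz tD tZ tK scalerDr epsZK addrC. Qed.
Lemma symz_linear : linear symz.
Proof.
move=> k x y; rewrite /symz t_linear !scalerDr !scalerA [eps * k]mulrC.
by rewrite -!addrA; congr (_ + _); rewrite addrCA.
Qed.
Lemma psi_linear : linear psi.
Proof. by move=> k x y; rewrite /psi symz_linear pi_linear//; apply: symzE. Qed.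
Let psiD x y : psi (x + y) = psi x + psi y := linear_funD psi_linear x y.
Let psi0 : psi 0 = 0 := linear_fun0 psi_linear.
Let psiZ (k : R[i]) x : psi (k *: x) = k *: psi x := linear_funZ psi_linear k x.
Lemma psi_t y : psi (t y) = eps *: psi y.
Proof.
rewrite /psi -piZ; last exact: symzE.
by congr pi; rewrite /symz scalerDr epsZK tK addrC.
Qed.

Definition corner i j x := e i i ** x = x /\ x ** e j j = x.

Lemma corner_mu i j : corner i j (e i j).
Proof. by split; rewrite (muMx emu). Qed.
Lemma cornerM i j k x y : corner i j x -> corner j k y -> corner i k (x ** y).
Proof. by move=> [ix xj] [jy yk]; split; rewrite ?cmulA ?ix -?cmulA ?yk. Qed.
Lemma cornerM0 i j k l x y : corner i j x -> corner k l y -> j != k -> x ** y = 0.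
Proof.
move=> [_ <-] [<- _] jk; rewrite -cmulA [e j j ** _]cmulA (muM0 emu)//.
by rewrite cmul0l cmul0r.
Qed.
Lemma corner_star i j x : corner i j x -> corner j i x^#.
Proof. by move=> [ix xj]; split; rewrite -(mu_star emu) -cstarM ?ix ?xj. Qed.
Lemma corner_t i j x : corner i j x -> corner j i (t x).
Proof. by move=> [ix xj]; split; rewrite -te -tM ?ix ?xj. Qed.
Lemma corner_et i j x : corner i j x -> corner j i (eps *: t x).
Proof. by move=> /corner_t[h1 h2]; split; rewrite ?cmulZl ?cmulZr ?h1 ?h2. Qed.
Lemma corner_cut i j x : corner i j (e i i ** x ** e j j).
Proof.
by split; [rewrite !cmulA (muMx emu)|rewrite -cmulA (muMx emu)].
Qed.
Lemma cut_corner i j x : x = e i i ** x ** e j j -> corner i j x.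
Proof. by move=> ->; exact: corner_cut. Qed.
Lemma corner_cutE i j x : corner i j x -> x = e i i ** x ** e j j.
Proof. by case=> -> ->. Qed.
Lemma cornerK i j k x : corner i j x -> e i k ** (e k i ** x) = x.
Proof. by case=> ix _; rewrite cmulA (muMx emu). Qed.
Lemma cornerKr i j k x : corner i j x -> x ** e j k ** e k j = x.
Proof. by case=> _ xj; rewrite -cmulA (muMx emu). Qed.

(** On [E] the map [symz] doubles, so the assumed identity reads [2 pi x = 2 f x] there; both of its
    sides are additive in y, hence it may be tested corner by corner. *)
Lemma extension_of_corners (f : A -> D) : linear f ->
  (forall i j y, corner i j y -> psi y = f y + eps *: f (t y)) ->
  forall x, E x -> f x = pi x.
Proof.
move=> lf fpsi x Ex.
have fD := linear_funD lf; have f0 := linear_fun0 lf; have fZ := linear_funZ lf.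
have psif : psi x = f x + eps *: f (t x).
  pose g y := f y + eps *: f (t y).
  have gD u v : g (u + v) = g u + g v by rewrite /g tD !fD scalerDr addrACA.
  have g0 : g 0 = 0 by rewrite /g t0 f0 scaler0 addr0.
  rewrite -/(g x) -(mu_sum2 emu x) (big_morph psi psiD psi0) (big_morph g gD g0).
  apply: eq_bigr => i _; rewrite (big_morph psi psiD psi0) (big_morph g gD g0).
  by apply: eq_bigr => j _; apply: fpsi; exact: corner_cut.
have two : (2 : R[i]) != 0 by rewrite pnatr_eq0.
apply: (scalerI two); rewrite !scaler_nat 2![_ *+ 2]mulr2n -piD//.
by move: psif; rewrite Ex fZ epsZK => <-; rewrite /psi /symz Ex epsZK.
Qed.

(** Every cross term meets at two distinct indices. The case k = i is allowed, and through it the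
    diagonal corners are reached. *)
Lemma tro_symz i j k l x y z : corner i j x -> corner l j y -> corner l k z ->
  i != j -> j != l -> l != k -> i != l ->
  symz x ** (symz y)^# ** symz z = x ** y^# ** z.
Proof.
move=> cx cy cz ij jl lk il; have cy' := corner_star (corner_et cy).
have cys := corner_star cy; have cx' := corner_et cx; have cz' := corner_et cz.
have -> : symz x ** (symz y)^# = x ** y^#.
  rewrite /symz cstarD cmulDl !cmulDr (cornerM0 cx cy')// (cornerM0 cx' cys)//.
  by rewrite (cornerM0 cx' cy')// !addr0.
by rewrite /symz cmulDr -[X in _ + X]cmulA (cornerM0 cys cz')// cmul0r addr0.
Qed.

Lemma psi_tro i j k l x y z : corner i j x -> corner l j y -> corner l k z ->
  i != j -> j != l -> l != k -> i != l ->
  psi x ** (psi y)^# ** psi z + psi z ** (psi y)^# ** psi x = psi (x ** y^# ** z).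
Proof.
move=> cx cy cz ij jl lk il; rewrite -pi_tro; try exact: symzE.
congr pi; rewrite -[symz z ** _ ** _]epsZK -t_tro; try exact: symzE.
by rewrite (tro_symz cx cy cz).
Qed.

Definition U i j := psi (e i j).

(** Both supports of the partial isometry [symz (e i j)] equal [e i i + e j j], so Jordan
    multiplication by [U i j] detects whether y lives on the indices i and j. *)
Lemma psi_UU i j y : i != j -> U i j ** (U i j)^# ** psi y + psi y ** (U i j)^# ** U i j =
  pi ((e i i + e j j) ** symz y + symz y ** (e i i + e j j)).
Proof.
move=> ij; rewrite -pi_tro; try exact: symzE.
have ji : j != i by rewrite eq_sym.
have us : (symz (e i j))^# = e j i + eps *: e i j.
  by rewrite /symz te cstarD cstarZ !(mu_star emu) eps_conj.
have ssE : symz (e i j) ** (symz (e i j))^# = e i i + e j j.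
  rewrite us /symz te cmulDl !cmulDr !(cmulZl, cmulZr) epsZK !(muMx emu).
  by rewrite !(muM0 emu) // !scaler0 addr0 add0r.
have ssE' : (symz (e i j))^# ** symz (e i j) = e i i + e j j.
  rewrite us /symz te cmulDl !cmulDr !(cmulZl, cmulZr) epsZK !(muMx emu).
  by rewrite !(muM0 emu) // !scaler0 addr0 add0r addrC.
by congr pi; rewrite -[symz y ** _ ** _]cmulA ssE ssE'.
Qed.
Lemma symz_unit2 i j y : corner i j y -> i != j ->
  (e i i + e j j) ** symz y = symz y /\ symz y ** (e i i + e j j) = symz y.
Proof.
move=> cy ij; have [iy yj] := cy; have cy' := corner_et cy.
have [jy yi] := cy'; have ji : j != i by rewrite eq_sym.
have [ci cj] := (corner_mu i i, corner_mu j j).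
rewrite /symz cmulDl !cmulDr cmulDl iy jy (cornerM0 ci cy')// (cornerM0 cj cy)//.
rewrite addr0 add0r; split=> //.
by rewrite cmulDl yj yi (cornerM0 cy ci)// (cornerM0 cy' cj)// addr0 add0r addrC.
Qed.

Lemma symz_unit0 i j k l y : corner k l y ->
  i != k -> i != l -> j != k -> j != l ->
  (e i i + e j j) ** symz y = 0 /\ symz y ** (e i i + e j j) = 0.
Proof.
move=> cy ik il jk jl; have cy' := corner_et cy.
have [ci cj] := (corner_mu i i, corner_mu j j).
rewrite /symz cmulDl !cmulDr !cmulDl.
rewrite (cornerM0 ci cy)// (cornerM0 ci cy')// (cornerM0 cj cy)// (cornerM0 cj cy')//.
rewrite (cornerM0 cy ci) 1?eq_sym// (cornerM0 cy' ci) 1?eq_sym//.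
by rewrite (cornerM0 cy cj) 1?eq_sym// (cornerM0 cy' cj) 1?eq_sym// !addr0.
Qed.

Lemma U_tripotent i j : i != j -> U i j ** (U i j)^# ** U i j = U i j.
Proof.
move=> ij; apply: double_inj; rewrite psi_UU//.
have [-> ->] := symz_unit2 (corner_mu i j) ij.
by rewrite piD//; exact: symzE.
Qed.

Lemma psi_supp i j y : corner i j y -> i != j ->
  U i j ** (U i j)^# ** psi y = psi y /\ psi y ** (U i j)^# ** U i j = psi y.
Proof.
move=> cy ij; apply: peirce2; first exact: U_tripotent.
rewrite psi_UU//; have [-> ->] := symz_unit2 cy ij.
by rewrite piD//; exact: symzE.
Qed.

Lemma psi_orth i j k l y : corner k l y -> i != j ->
  i != k -> i != l -> j != k -> j != l ->
  U i j ** (U i j)^# ** psi y = 0 /\ psi y ** (U i j)^# ** U i j = 0.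
Proof.
move=> cy ij ik il jk jl; apply: peirce0; first exact: U_tripotent.
rewrite psi_UU//; have [-> ->] := symz_unit0 cy ik il jk jl.
by rewrite addr0 pi0.
Qed.

(** Of the two terms of [psi_tro], the left support of [U i j] fixes the one that starts with
    [psi x] and kills the one that starts with [psi z], because l and k avoid i and j. *)
Lemma psi_left i j k l x y z : corner i j x -> corner l j y -> corner l k z ->
  uniq [:: i; j; k; l] ->
  U i j ** (U i j)^# ** psi (x ** y^# ** z) = psi x ** (psi y)^# ** psi z.
Proof.
move=> cx cy cz; rewrite /= !inE !negb_or -!andbA => /and5P[ij ik il jk /and3P[jl kl _]].
have lk : l != k by rewrite eq_sym.
rewrite -(psi_tro cx cy cz)// cmulDr !cmulA.
have [-> _] := psi_supp cx ij.
by have [-> _] := psi_orth cz ij il ik jl jk; rewrite !cmul0l addr0.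
Qed.

Lemma psi_right i j k l x y z : corner i j x -> corner l j y -> corner l k z ->
  uniq [:: i; j; k; l] ->
  psi (x ** y^# ** z) ** (U l k)^# ** U l k = psi x ** (psi y)^# ** psi z.
Proof.
move=> cx cy cz; rewrite /= !inE !negb_or -!andbA => /and5P[ij ik il jk /and3P[jl kl _]].
have lk : l != k by rewrite eq_sym.
rewrite -(psi_tro cx cy cz)// !cmulDl -!cmulA.
have [_] := psi_supp cz lk; rewrite -cmulA => ->.
have [li lj ki kj] : [/\ l != i, l != j, k != i & k != j].
  by split; rewrite eq_sym.
by have [_] := psi_orth cx lk li lj ki kj; rewrite -!cmulA => ->; rewrite !cmul0r addr0.
Qed.

(* With [i], [j], [k], [l] distinct, the left support of [U i j] and the right
   support of [U l k] cut the same part out of [psi y], which therefore depends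
   neither on [j] nor on [l] as soon as a fifth index is available. *)
Lemma psi_left_right i j k l y : corner i k y -> uniq [:: i; j; k; l] ->
  U i j ** (U i j)^# ** psi y = psi y ** (U l k)^# ** U l k.
Proof.
move=> cy ijkl; have yE : y = y ** e k j ** (e l j)^# ** e l k.
  by rewrite (mu_star emu) -[_ ** e j l]cmulA (muMx emu) (cornerKr _ cy).
have cyj := cornerM cy (corner_mu k j).
rewrite yE (psi_left cyj (corner_mu l j) (corner_mu l k))//.
by rewrite (psi_right cyj (corner_mu l j) (corner_mu l k)).
Qed.

(** * At least five rows: calculus of off-diagonal entries *)

Section Generic.
Hypothesis n5 : (4 < n)%N.

Lemma ex_fresh (s : seq 'I_n) : (size s < 5)%N -> exists i, i \notin s.
Proof.
move=> s5; apply/existsP; rewrite -[X in is_true X]negbK negb_exists.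
apply/negP => /forallP sT.
have : (size (enum 'I_n) <= size s)%N.
  by apply: uniq_leq_size (enum_uniq _) _ => i _; have := sT i; rewrite negbK.
by rewrite size_enum_ord leqNgt (leq_trans s5).
Qed.

(** The candidate for the image of y alone, whereas [psi y] mixes y with its transpose. As n >= 5
    the [pick] succeeds, so the default i never occurs. *)
Definition off i k y :=
  let j := odflt i [pick j | j \notin [:: i; k]] in U i j ** (U i j)^# ** psi y.

Lemma offL i j k y : corner i k y -> i != k -> j \notin [:: i; k] ->
  off i k y = U i j ** (U i j)^# ** psi y.
Proof.
move=> cy ik jik; rewrite /off; case: pickP => [m mik|/(_ j)]; last by rewrite jik.
(* The fifth index: the left cuts through j and through m both equal the right cut by [U l k]. *)
have [l lF] := @ex_fresh [:: i; k; j; m] isT.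
by rewrite (@psi_left_right i m k l)// ?(@psi_left_right i j k l)//; distinct.
Qed.

Lemma offR i j k y : corner i k y -> i != k -> j \notin [:: i; k] ->
  off i k y = psi y ** (U j k)^# ** U j k.
Proof.
move=> cy ik jik; have [m mF] := @ex_fresh [:: i; k; j] isT.
by rewrite (@offL i m)// ?(@psi_left_right i m k j)//; distinct.
Qed.

Lemma off_linear i k : linear (off i k).
Proof. by move=> c x y; rewrite /off psi_linear cmul_linearr. Qed.

(** The summands are the two terms of [psi_tro] for a factorization of y; the left support at i
    isolates the first, and the left support at k, applied to the transposed factorization, isolates
    the second. *)
Lemma psi_off i k y : corner i k y -> i != k ->
  psi y = off i k y + eps *: off k i (t y).
Proof.
move=> cy ik; have [j jF] := @ex_fresh [:: i; k] isT.
have [l lF] := @ex_fresh [:: i; k; j] isT.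
have cyj := cornerM cy (corner_mu k j).
have [clj clk] := (corner_mu l j, corner_mu l k).
have yE : y = y ** e k j ** (e l j)^# ** e l k.
  by rewrite (mu_star emu) -[_ ** e j l]cmulA (muMx emu) (cornerKr _ cy).
have tyE : t y = t (e l k) ** (t (e l j))^# ** t (y ** e k j).
  by rewrite {1}yE !tM t_star !cmulA.
rewrite (@offL i j)//; try by distinct.
rewrite (offL (j := l) (corner_t cy)); try by distinct.
rewrite tyE (psi_left (corner_t clk) (corner_t clj) (corner_t cyj)); try by distinct.
rewrite {2}yE (psi_left cyj clj clk); try by distinct.
rewrite {1}yE -(psi_tro cyj clj clk); try by distinct.
congr (_ + _); rewrite !psi_t cstarZ eps_conj.
by rewrite !(cmulZl, cmulZr) !epsZK.
Qed.

(** Fresh m and p turn the right supports into those of [U m k] and [U p l], which are orthogonal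
    even if i = j, i = l or j = k. *)
Lemma off_orthr i j k l x y : corner i k x -> corner j l y -> i != k -> j != l ->
  k != l -> off i k x ** (off j l y)^# = 0.
Proof.
move=> cx cy ik jl kl; have [m mF] := @ex_fresh [:: i; k; l] isT.
have [p pF] := @ex_fresh [:: j; l; k; m] isT.
rewrite (offR (j := m) cx)//; try by distinct.
rewrite (offR (j := p) cy)//; try by distinct.
have [|||||_ h] := @psi_orth p l m k _ (corner_mu m k); try by distinct.
have {}h : U m k ** ((U p l)^# ** (U p l ** (psi y)^#)) = 0.
  by rewrite !cmulA h cmul0l.
by rewrite !cstarM cstarK -!cmulA h !cmul0r.
Qed.

Lemma off_orthl i j k l x y : corner i k x -> corner j l y -> i != k -> j != l ->
  i != j -> (off i k x)^# ** off j l y = 0.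
Proof.
move=> cx cy ik jl ij; have [m mF] := @ex_fresh [:: i; k; j] isT.
have [p pF] := @ex_fresh [:: j; l; i; m] isT.
rewrite (offL (j := m) cx)//; try by distinct.
rewrite (offL (j := p) cy)//; try by distinct.
have [|||||h _] := @psi_orth i m j p _ (corner_mu j p); try by distinct.
have {}h : U i m ** ((U i m)^# ** (U j p ** ((U j p)^# ** psi y))) = 0.
  by rewrite !cmulA h !cmul0l.
by rewrite !cstarM cstarK -!cmulA h cmul0r.
Qed.

Lemma psi_off_tro i j k l x y z : corner i j x -> corner l j y -> corner l k z ->
  i != j -> l != j -> l != k -> i != l ->
  psi x ** (psi y)^# ** psi z = off i j x ** (off l j y)^# ** off l k z.
Proof.
move=> cx cy cz ij lj lk il.
have [[cx' cy'] cz'] := (corner_t cx, corner_t cy, corner_t cz).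
rewrite (psi_off cx)// (psi_off cy)// (psi_off cz)// cstarD cstarZ eps_conj.
have -> : (off i j x + eps *: off j i (t x)) **
    ((off l j y)^# + eps *: (off j l (t y))^#) = off i j x ** (off l j y)^#.
  rewrite cmulDl !cmulDr !(cmulZl, cmulZr) (off_orthr cx cy'); try by distinct.
  rewrite (off_orthr cx' cy); try by distinct.
  rewrite (off_orthr cx' cy'); try by distinct.
  by rewrite !scaler0 !addr0.
rewrite cmulDr cmulZr -[X in _ + _ *: X]cmulA (off_orthl cy cz'); try by distinct.
by rewrite cmul0r scaler0 addr0.
Qed.

Lemma off_tro4 i j k l x y z : corner i j x -> corner l j y -> corner l k z ->
  uniq [:: i; j; k; l] ->
  off i j x ** (off l j y)^# ** off l k z = off i k (x ** y^# ** z).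
Proof.
move=> cx cy cz ijkl; have cxyz := cornerM (cornerM cx (corner_star cy)) cz.
rewrite -(psi_off_tro cx cy cz); try by distinct.
rewrite (offL (j := j) cxyz); try by distinct.
by rewrite (psi_left cx cy cz).
Qed.

Lemma off_tro i j k l x y z : corner i j x -> corner l j y -> corner l k z ->
  i != j -> l != j -> l != k -> i != k ->
  off i j x ** (off l j y)^# ** off l k z = off i k (x ** y^# ** z).
Proof.
(* Moving the outer indices through fresh ones reduces to distinct indices. *)
wlog il : l y z / i != l => [wl cx cy cz ij lj lk ik|].
  have [p pF] := @ex_fresh [:: i; j; k; l] isT.
  have [m mF] := @ex_fresh [:: l; j; k; p] isT.
  have cy' := cornerM (corner_mu p l) cy; have cz' := cornerM (corner_mu p l) cz.
  have {1}-> : y = e l m ** (e p m)^# ** (e p l ** y).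
    by rewrite (mu_star emu) (muMx emu) (cornerK _ cy).
  rewrite -(off_tro4 (corner_mu l m) (corner_mu p m) cy'); try by distinct.
  (* The adjoint reverses the factorization of y, so its outer part can be absorbed into z and the
     index l is replaced by the fresh p. *)
  have starE (a b c d w : D) : a ** (b ** c^# ** d)^# ** w = a ** d^# ** (c ** b^# ** w).
    by rewrite !cstarM cstarK !cmulA.
  rewrite starE.
  rewrite (off_tro4 (corner_mu p m) (corner_mu l m) cz); try by distinct.
  have -> : e p m ** (e l m)^# ** z = e p l ** z.
    by rewrite (mu_star emu) (muMx emu).
  rewrite wl//; try by distinct.
  rewrite cstarM (mu_star emu) -!cmulA; congr (off _ _ (_ ** (_ ** _))).
  exact: cornerK cz.
have [jk|jk] := eqVneq j k; last first.
  by move=> cx cy cz ij lj lk ik; apply: off_tro4 => //; distinct.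
rewrite -{k}jk => cx cy cz ij lj _ _.
have [m mF] := @ex_fresh [:: i; j; l] isT.
have [q qF] := @ex_fresh [:: i; j; l; m] isT.
have cz' := cornerM cz (corner_mu j m).
have {1}-> : z = z ** e j m ** (e q m)^# ** e q j.
  by rewrite (mu_star emu) -[_ ** e m q]cmulA (muMx emu) (cornerKr _ cz).
rewrite -(off_tro4 cz' (corner_mu q m) (corner_mu q j)); try by distinct.
have assocE (a b c d : D) : a ** (b ** c ** d) = a ** b ** c ** d by rewrite !cmulA.
rewrite assocE (off_tro4 cx cy cz'); try by distinct.
have cw := cornerM (cornerM cx (corner_star cy)) cz'.
rewrite (off_tro4 cw (corner_mu q m) (corner_mu q j)); try by distinct.
congr (off _ _ _); rewrite (mu_star emu) !cmulA -[_ ** e j m ** _]cmulA (muMx emu).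
by rewrite -cmulA (muMx emu) -!cmulA (proj2 cz).
Qed.

Definition other (a : 'I_n) (s : seq 'I_n) := odflt a [pick j | j \notin s].
Lemma otherP a s : (size s < 5)%N -> other a s \notin s.
Proof.
by move=> /ex_fresh[i si]; rewrite /other; case: pickP => // /(_ i); rewrite si.
Qed.

Section Frame.
Variables (a b : 'I_n).
Hypothesis ab : a != b.

(** Stands for the left matrix unit [e i a], written as [e i k ** (e a k)^#]; the detour through k
    makes both factors off-diagonal even when i = a. Likewise [rframe j] stands for [e b j]. *)
Definition lframe i :=
  let k := other a [:: a; i; b] in off i k (e i k) ** (off a k (e a k))^#.
Definition rframe j :=
  let m := other a [:: a; j; b] in (off m b (e m b))^# ** off m j (e m j).

Lemma lframe_off i k x : x = e a a ** x ** e b b ->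
  (lframe i)^# ** lframe k ** off a b x = if i == k then off a b x else 0.
Proof.
move=> /cut_corner cx; rewrite /lframe.
have /= := @otherP a [:: a; i; b] isT; set p := other _ _ => pF.
have /= := @otherP a [:: a; k; b] isT; set q := other _ _ => qF.
have -> (u v w z s : D) : (u ** v^#)^# ** (w ** z^#) ** s =
    v ** (u^# ** w) ** z^# ** s by rewrite !cstarM cstarK !cmulA.
case: eqVneq => [ik|ik]; last first.
  rewrite (off_orthl (corner_mu i p) (corner_mu k q)); try by distinct.
  by rewrite cmul0r !cmul0l.
move: @q qF; rewrite -{k}ik => /= _.
rewrite cmulA (off_tro (corner_mu a p) (corner_mu i p) (corner_mu i p)); try by distinct.
rewrite !(mu_star emu) !(muMx emu).
rewrite (off_tro (corner_mu a p) (corner_mu a p) cx); try by distinct.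
by rewrite (mu_star emu) (muMx emu) (proj1 cx).
Qed.

Lemma rframe_off j k x : x = e a a ** x ** e b b ->
  off a b x ** rframe j ** (rframe k)^# = if j == k then off a b x else 0.
Proof.
move=> /cut_corner cx; rewrite /rframe.
have /= := @otherP a [:: a; j; b] isT; set p := other _ _ => pF.
have /= := @otherP a [:: a; k; b] isT; set q := other _ _ => qF.
have -> (u v w z s : D) : s ** (u^# ** v) ** (w^# ** z)^# =
    s ** u^# ** (v ** z^# ** w) by rewrite !cstarM cstarK !cmulA.
case: eqVneq => [jk|jk]; last first.
  rewrite (off_orthr (corner_mu p j) (corner_mu q k)); try by distinct.
  by rewrite cmul0l cmul0r.
move: @q qF; rewrite -{k}jk => /= _.
rewrite (off_tro (corner_mu p j) (corner_mu p j) (corner_mu p b)); try by distinct.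
rewrite !(mu_star emu) !(muMx emu).
rewrite (off_tro cx (corner_mu p b) (corner_mu p b)); try by distinct.
by rewrite (mu_star emu) -cmulA (muMx emu) (proj2 cx).
Qed.

Lemma off_frame_tro x y z : x = e a a ** x ** e b b ->
  y = e a a ** y ** e b b -> z = e a a ** z ** e b b ->
  off a b x ** (off a b y)^# ** off a b z = off a b (x ** y^# ** z).
Proof. by move=> /cut_corner cx /cut_corner cy /cut_corner cz; exact: off_tro. Qed.

Let f := coord_map e a b (off a b) lframe rframe.

Lemma coord_map_tro_off x y z : f (x ** y^# ** z) = f x ** (f y)^# ** f z.
Proof.
exact: (coord_map_tro emu (@off_linear a b) lframe_off rframe_off off_frame_tro).
Qed.

Lemma coord_map_off i j y : corner i j y -> i != j -> f y = off i j y.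
Proof.
move=> cy ij; rewrite /f (coord_map_corner emu _ _ _ _ (@off_linear a b) (corner_cutE cy)).
rewrite /lframe /rframe.
have /= := @otherP a [:: a; i; b] isT; set k := other _ _ => kF.
have /= := @otherP a [:: a; j; b] isT; set q := other _ _ => qF.
(* Applying [lframe i] directly to the corner (a, b) would land in the corner (i, b), which is
   diagonal when i = b; routing through m and p avoids this. *)
have [m mF] := @ex_fresh [:: a; i] isT.
have [p pF] := @ex_fresh [:: b; j; m] isT.
set z := _ ** e j b; have cz : corner a b z.
  exact: cornerM (cornerM (corner_mu a i) cy) (corner_mu j b).
have czm := cornerM cz (corner_mu b m).
have zE : z = z ** e b m ** (e p m)^# ** e p b.
  by rewrite (mu_star emu) -[_ ** e m p]cmulA (muMx emu) (cornerKr _ cz).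
rewrite zE -(off_tro czm (corner_mu p m) (corner_mu p b)); try by distinct.
have -> (u v w u' v' s r : D) : u ** v ** (w ** u' ** v') ** (s ** r) =
    u ** v ** w ** u' ** (v' ** s ** r) by rewrite !cmulA.
rewrite (off_tro (corner_mu i k) (corner_mu a k) czm); try by distinct.
rewrite (off_tro (corner_mu p b) (corner_mu q b) (corner_mu q j)); try by distinct.
rewrite !(mu_star emu) !(muMx emu).
have cw := cornerM (corner_mu i a) czm.
rewrite (off_tro cw (corner_mu p m) (corner_mu p j)); try by distinct.
congr (off _ _ _); rewrite /z (mu_star emu) !cmulA (muMx emu) (proj1 cy).
by rewrite -!cmulA !(muMx emu) (proj2 cy).
Qed.

Lemma coord_map_psi i j y : corner i j y -> psi y = f y + eps *: f (t y).
Proof.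
move=> cy; have [ij|ij] := eqVneq i j; last first.
  rewrite (psi_off cy ij) (coord_map_off cy ij).
  by rewrite (coord_map_off (corner_t cy)) 1?eq_sym.
move: cy; rewrite -{j}ij => cy.
(* A diagonal y is a triple product of off-diagonal elements, on which [f] is already known to be
   [off]; [psi_tro] and the multiplicativity of [f] both permit a diagonal result. *)
have [m mF] := @ex_fresh [:: i] isT; have [p pF] := @ex_fresh [:: i; m] isT.
have cx := cornerM cy (corner_mu i m).
have [cpm cpi] := (corner_mu p m, corner_mu p i).
have yE : y = y ** e i m ** (e p m)^# ** e p i.
  by rewrite (mu_star emu) -[_ ** e m p]cmulA (muMx emu) (cornerKr _ cy).
have tyE : t y = t (e p i) ** (t (e p m))^# ** t (y ** e i m).
  by rewrite {1}yE !tM t_star !cmulA.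
rewrite tyE {1 2}yE -(psi_tro cx cpm cpi); try by distinct.
rewrite !coord_map_tro_off; congr (_ + _).
  rewrite (coord_map_off cx) ?(coord_map_off cpm) ?(coord_map_off cpi); try by distinct.
  by rewrite (psi_off_tro cx cpm cpi); try by distinct.
have [[tcx tcpm] tcpi] := (corner_t cx, corner_t cpm, corner_t cpi).
rewrite (coord_map_off tcx) ?(coord_map_off tcpm) ?(coord_map_off tcpi); try by distinct.
rewrite -(psi_off_tro tcpi tcpm tcx); try by distinct.
by rewrite !psi_t cstarZ eps_conj !(cmulZl, cmulZr) !epsZK.
Qed.

End Frame.

Lemma generic_extension : exists f : A -> D, [/\ linear f,
  forall x y z, f (tro_prod x y z) = tro_prod (f x) (f y) (f z) &
  forall x, t x = eps *: x -> f x = pi x].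
Proof.
pose a := Ordinal (ltn_trans (isT : 0 < 4)%N n5).
pose b := Ordinal (ltn_trans (isT : 1 < 4)%N n5).
have ab : a != b by [].
pose f := coord_map e a b (off a b) (lframe a b) (rframe a b).
exists f; split; first exact: (coord_map_linear _ _ _ _ _ (@off_linear a b)).
  exact: coord_map_tro_off.
apply: extension_of_corners; first exact: (coord_map_linear _ _ _ _ _ (@off_linear a b)).
exact: coord_map_psi.
Qed.

Lemma generic_generated (P : set A) : P 0 ->
  (forall x y, P x -> P y -> P (x + y)) ->
  (forall x y z, t x = eps *: x -> t y = eps *: y -> t z = eps *: z ->
     P (tro_prod x y z)) ->
  forall x, P x.
Proof.
move=> P0 PD PE x; rewrite -(mu_sum2 emu x).
apply: (big_ind P) => // i _; apply: (big_ind P) => // k _.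
have := corner_cut i k x; move: (_ ** _) => y cy.
have [m mF] := @ex_fresh [:: i; k] isT; have [p pF] := @ex_fresh [:: i; k; m] isT.
have -> : y = y ** e k m ** (e p m)^# ** e p k.
  by rewrite (mu_star emu) -[_ ** e m p]cmulA (muMx emu) (cornerKr _ cy).
have cym := cornerM cy (corner_mu k m).
rewrite -(tro_symz cym (corner_mu p m) (corner_mu p k)); try by distinct.
by apply: PE; exact: symzE.
Qed.

End Generic.

(* Matrices over the scalars: this covers [S_2], [S_3] and [S_4], where there are
   too few indices for the argument above. The diagonal matrix units belong to
   the triple. *)
Section Scalar.
Hypothesis eps_1 : eps = 1.
Hypothesis scal : forall i j x, exists c : R[i], e i i ** x ** e j j = c *: e i j.

Lemma mu_E i : E (e i i).
Proof. by rewrite /E te eps_1 scale1r. Qed.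

Lemma corner_scal i j y : corner i j y -> exists c : R[i], y = c *: e i j.
Proof. by move=> cy; have [c] := scal i j y; rewrite -corner_cutE// => ->; exists c. Qed.

Let v i := pi (e i i).
Let w i j := U i j.
(** Since $e_{ii}(e_{ij}+e_{ji})^*e_{jj} = e_{ij}$, this is the candidate for the image of [e i j]
    when i != j. *)
Let g i j := v i ** (w i j)^# ** v j.

Lemma U_sym i j : U i j = U j i.
Proof. by rewrite /U -[e j i]te psi_t eps_1 scale1r. Qed.

Lemma symz_mu i j : symz (e i j) = e i j + e j i.
Proof. by rewrite /symz te eps_1 scale1r. Qed.

Lemma pi_mu_tripotent i : v i ** (v i)^# ** v i = v i.
Proof.
apply: double_inj; rewrite -pi_tro; try exact: mu_E.
by rewrite (mu_star emu) !(muMx emu) piD//; exact: mu_E.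
Qed.

Lemma pi_mu_orth i j : i != j -> v i ** (v j)^# = 0 /\ (v i)^# ** v j = 0.
Proof.
move=> ij; have ji : j != i by rewrite eq_sym.
have [|h1 h2] := peirce0 (pi_mu_tripotent i) (x := v j).
  rewrite -pi_tro; try exact: mu_E.
  rewrite (mu_star emu) (muMx emu) (muM0 emu _ _ ij) -cmulA (muMx emu).
  by rewrite (muM0 emu _ _ ji) addr0 pi0.
have st k : (v k)^# ** v k ** (v k)^# = (v k)^#.
  by rewrite -[in RHS]pi_mu_tripotent !cstarM cstarK cmulA.
split; last by rewrite -st -!cmulA [v i ** _]cmulA h1 cmul0r.
apply: (can_inj (@cstarK R D)); rewrite cstar0 cstarM cstarK.
by rewrite -st 2!cmulA h2 cmul0l.
Qed.

Lemma pi_mu_diag0 i j : i != j -> v i ** (w i j)^# ** v i = 0.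
Proof.
move=> ij; have ji : j != i by rewrite eq_sym.
apply: double_inj; rewrite -pi_tro; try exact: symzE; try exact: mu_E.
rewrite symz_mu cstarD !(mu_star emu) cmulDr (muMx emu) (muM0 emu _ _ ij).
by rewrite add0r (muM0 emu _ _ ji) addr0 pi0 addr0.
Qed.

Lemma U_split i j : i != j -> w i j = g i j + g j i.
Proof.
move=> ij; rewrite /g -[w j i]U_sym -pi_tro; try exact: symzE; try exact: mu_E.
have ji : j != i by rewrite eq_sym.
rewrite /w /U /psi; congr pi; rewrite symz_mu cstarD !(mu_star emu) !cmulDr.
rewrite (muM0 emu _ _ ij) (muMx emu) add0r (muMx emu) (muM0 emu _ _ ji) addr0.
by rewrite !(muMx emu).
Qed.

(** The symmetric sum built from [w i j], [w i j], [v i] equals [2 v i], and by [pi_mu_diag0] each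
    of its two terms is the left-hand side. *)
Lemma g_cycle i j : i != j -> g i j ** (w i j)^# ** v i = v i.
Proof.
move=> ij; have ji : j != i by rewrite eq_sym.
have d0 := pi_mu_diag0 ij.
have l1 : w i j ** (w i j)^# ** v i = g i j ** (w i j)^# ** v i.
  rewrite {1}(U_split ij) !cmulDl -[RHS]addr0; congr (_ + _).
  by rewrite /g -!cmulA [v i ** _]cmulA d0 !cmul0r.
have l2 : v i ** (w i j)^# ** w i j = g i j ** (w i j)^# ** v i.
  rewrite {2}(U_split ij) cmulDr /g -[w j i]U_sym !cmulA.
  by rewrite d0 !cmul0l add0r.
apply: double_inj; rewrite -{1}l1 -l2.
rewrite /w /U /psi /v -pi_tro; try exact: symzE; try exact: mu_E.
rewrite symz_mu cstarD !(mu_star emu).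
have -> : (e i j + e j i) ** (e j i + e i j) = e i i + e j j.
  by rewrite cmulDl !cmulDr !(muMx emu) (muM0 emu _ _ ji) (muM0 emu _ _ ij) addr0 add0r.
have -> : e i i ** (e j i + e i j) ** (e i j + e j i) = e i i.
  rewrite [e i i ** _]cmulDr (muM0 emu _ _ ij) (muMx emu) add0r cmulDr.
  by rewrite (muMx emu) (muM0 emu _ _ ji) add0r.
rewrite cmulDl (muMx emu) (muM0 emu _ _ ji) addr0.
by rewrite piD//; exact: mu_E.
Qed.

Variable a : 'I_n.
(** [F i] and [G j] stand for [e i a] and [e a j]. The index a is treated apart because [w a a],
    hence also [g a a], is twice [v a]. *)
Let F i := if i == a then v a else g i a.
Let G j := if j == a then v a else g a j.

Let FE i : exists x : D, F i = v i ** x.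
Proof.
rewrite /F; case: eqVneq => [->|_]; last by exists ((w i a)^# ** v a); rewrite cmulA.
by exists ((v a)^# ** v a); rewrite cmulA pi_mu_tripotent.
Qed.
Let GE j : exists x : D, G j = x ** v j.
Proof.
rewrite /G; case: eqVneq => [->|_]; last by exists (v a ** (w a j)^#).
by exists (v a ** (v a)^#); rewrite pi_mu_tripotent.
Qed.

Let FF i k : v a ** (F i)^# ** F k = if i == k then v a else 0.
Proof.
case: eqVneq => [<-|ik]; last first.
  have [[x ->] [y ->]] := (FE i, FE k).
  have [_ h] := pi_mu_orth ik.
  by rewrite cstarM -!cmulA [(v i)^# ** _]cmulA h cmul0l !cmul0r.
rewrite /F; case: eqVneq => [_|ia]; first exact: pi_mu_tripotent.
have ai : a != i by rewrite eq_sym.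
have wv : w i a ** (v i)^# ** v i = g a i.
  rewrite (U_split ia) !cmulDl /g -![_ ** v a ** (v i)^#]cmulA (proj1 (pi_mu_orth ai)).
  by rewrite cmul0r cmul0l add0r -!cmulA [v i ** _]cmulA pi_mu_tripotent.
have -> : v a ** (g i a)^# ** g i a =
    v a ** (v a)^# ** (w i a ** (v i)^# ** v i) ** (w i a)^# ** v a.
  by rewrite /g !cstarM cstarK !cmulA.
rewrite wv -[RHS](g_cycle ai) [w i a]U_sym; congr (_ ** _ ** _).
by rewrite /g !cmulA pi_mu_tripotent.
Qed.

Let GG j k : G j ** (G k)^# ** v a = if j == k then v a else 0.
Proof.
case: eqVneq => [<-|jk]; last first.
  have [[x ->] [y ->]] := (GE j, GE k).
  have [h _] := pi_mu_orth jk.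
  by rewrite cstarM cmulA -[x ** _ ** _]cmulA h cmul0r !cmul0l.
rewrite /G; case: eqVneq => [_|ja]; first exact: pi_mu_tripotent.
have aj : a != j by rewrite eq_sym.
have vw : v j ** (v j)^# ** w a j = g j a.
  rewrite (U_split aj) cmulDr /g -!cmulA [(v j)^# ** (v a ** _)]cmulA.
  by rewrite (proj2 (pi_mu_orth ja)) cmul0l cmul0r add0r !cmulA pi_mu_tripotent.
have -> : g a j ** (g a j)^# ** v a =
    v a ** (w a j)^# ** (v j ** (v j)^# ** w a j) ** (v a)^# ** v a.
  by rewrite /g !cstarM cstarK !cmulA.
rewrite vw -[RHS](g_cycle aj) -!cmulA [X in _ ** (_ ** X)](_ : _ = g j a).
  by rewrite /g [w j a]U_sym !cmulA.
by rewrite /g -!cmulA [v a ** (_ ** v a)]cmulA pi_mu_tripotent.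
Qed.

(** The scalar corner (a, a) lies in the triple, so [pi] itself serves as the map to be extended. *)
Let Theta x := pi (e a a ** x ** e a a).

Let ThetaP : linear Theta.
Proof.
move=> c x y; rewrite /Theta -pi_linear; first by rewrite cmul_linearr cmul_linearl.
  by have [d ->] := scal a a x; apply/EZ/mu_E.
by have [d ->] := scal a a y; apply/EZ/mu_E.
Qed.

Let ThetaZ (c : R[i]) : Theta (c *: e a a) = c *: v a.
Proof.
by rewrite /Theta cmulZr cmulZl !(muMx emu) piZ//; exact: mu_E.
Qed.

Let L i := F i ** (v a)^#.
Let M j := (v a)^# ** G j.

Let scalar_frameL i k x : x = e a a ** x ** e a a ->
  (L i)^# ** L k ** Theta x = if i == k then Theta x else 0.
Proof.
move=> /cut_corner/corner_scal[c ->]; rewrite ThetaZ /L cstarM cstarK cmulZr.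
have -> : v a ** (F i)^# ** (F k ** (v a)^#) ** v a = v a ** (F i)^# ** F k ** (v a)^# ** v a.
  by rewrite !cmulA.
by rewrite FF; case: eqP => _; rewrite ?pi_mu_tripotent// !cmul0l scaler0.
Qed.

Let scalar_frameR j k x : x = e a a ** x ** e a a ->
  Theta x ** M j ** (M k)^# = if j == k then Theta x else 0.
Proof.
move=> /cut_corner/corner_scal[c ->]; rewrite ThetaZ /M cstarM cstarK !cmulZl.
have -> : v a ** ((v a)^# ** G j) ** ((G k)^# ** v a) =
    v a ** ((v a)^# ** (G j ** (G k)^# ** v a)).
  by rewrite !cmulA.
by rewrite GG; case: eqP => _; rewrite ?cmulA ?pi_mu_tripotent// !cmul0r scaler0.
Qed.

Let scalar_frame_tro x y z : x = e a a ** x ** e a a ->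
  y = e a a ** y ** e a a -> z = e a a ** z ** e a a ->
  Theta x ** (Theta y)^# ** Theta z = Theta (x ** y^# ** z).
Proof.
move=> /cut_corner/corner_scal[c ->] /cut_corner/corner_scal[d ->].
move=> /cut_corner/corner_scal[s ->].
rewrite !ThetaZ !cstarZ (mu_star emu) !(cmulZl, cmulZr) !(muMx emu).
by rewrite !scalerA ThetaZ pi_mu_tripotent.
Qed.

Let f := coord_map e a a Theta L M.

Let f_linear : linear f := coord_map_linear e a a L M ThetaP.

Lemma coord_map_mu i j : f (e i j) = F i ** (v a)^# ** G j.
Proof.
rewrite /f (coord_map_corner emu _ _ _ _ ThetaP (corner_cutE (corner_mu i j))).
rewrite !(muMx emu) -[e a a]scale1r ThetaZ scale1r /L /M.
rewrite -!cmulA [v a ** _]cmulA -/(v a) [X in _ ** X](_ : _ = (v a)^# ** G j)//.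
have st : (v a)^# ** v a ** (v a)^# = (v a)^#.
  by rewrite -[in RHS]pi_mu_tripotent !cstarM cstarK cmulA.
by rewrite !cmulA !st.
Qed.

Lemma scalar_extension : exists f : A -> D, [/\ linear f,
  forall x y z, f (tro_prod x y z) = tro_prod (f x) (f y) (f z) &
  forall x, t x = eps *: x -> f x = pi x].
Proof.
exists f; split => //.
  exact: (coord_map_tro emu ThetaP scalar_frameL scalar_frameR scalar_frame_tro).
apply: extension_of_corners => // i j _ /corner_scal[c ->].
have fZ := linear_funZ f_linear.
rewrite psiZ tZ te !fZ eps_1 scale1r -scalerDr; congr (_ *: _).
rewrite !coord_map_mu -[psi _]/(w i j).
have Fr k : F k ** (v a)^# ** v a = F k.
  by rewrite /F; case: eqP => _; rewrite ?/g -?cmulA ?[v a ** _]cmulA pi_mu_tripotent.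
have Gl k : v a ** (v a)^# ** G k = G k.
  by rewrite /G; case: eqP => _; rewrite ?/g ?pi_mu_tripotent// !cmulA pi_mu_tripotent.
have Fa : F a = v a by rewrite /F eqxx.
have Ga : G a = v a by rewrite /G eqxx.
have [->|ia] := eqVneq i a.
  rewrite Fa Ga Gl Fr; have [->|ja] := eqVneq j a.
    rewrite Fa Ga /w /U /psi symz_mu piD//; exact: mu_E.
  by rewrite U_split 1?eq_sym// /F /G (negPf ja).
have [->|ja] := eqVneq j a.
  by rewrite Fa Ga Gl Fr U_split// /F /G (negPf ia) addrC.
have ai : a != i by rewrite eq_sym.
have aj : a != j by rewrite eq_sym.
have Fw k : k != a -> w k a ** (v a)^# = F k ** (v a)^#.
  move=> ka; have ak : a != k by rewrite eq_sym.
  rewrite (U_split ka) cmulDl /g /F (negPf ka) -[_ ** v k ** (v a)^#]cmulA.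
  by rewrite (proj1 (pi_mu_orth ka)) cmul0r addr0.
have Gw k : k != a -> (v a)^# ** w a k = (v a)^# ** G k.
  move=> ka; have ak : a != k by rewrite eq_sym.
  rewrite (U_split ak) cmulDr /g /G (negPf ka) -[v k ** _ ** _]cmulA [_ ** (v k ** _)]cmulA.
  by rewrite (proj2 (pi_mu_orth ak)) cmul0l addr0.
(* For i and j different from a, the symmetric sum built from $e_{ia}+e_{ai}$, $e_{aa}$ and
   $e_{aj}+e_{ja}$ is $e_{ij}+e_{ji}$, also when i = j. *)
rewrite -[F i ** _]Fw// -[F j ** _]Fw// -2!cmulA -!Gw// !cmulA.
rewrite [w j a]U_sym [w a i]U_sym -pi_tro; try exact: symzE; try exact: mu_E.
rewrite /w /U /psi; congr pi; rewrite !symz_mu (mu_star emu).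
have eL k : a != k -> (e k a + e a k) ** e a a = e k a.
  by move=> ak; rewrite cmulDl (muMx emu) (muM0 emu) 1?eq_sym// addr0.
have eR k l : a != k -> e l a ** (e a k + e k a) = e l k.
  by move=> ak; rewrite cmulDr (muMx emu) (muM0 emu _ _ ak) addr0.
by rewrite eL// eR// [e a j + _]addrC eL// [e i a + _]addrC eR.
Qed.

Lemma scalar_generated (P : set A) : P 0 ->
  (forall x y, P x -> P y -> P (x + y)) ->
  (forall x y z, t x = eps *: x -> t y = eps *: y -> t z = eps *: z ->
     P (tro_prod x y z)) ->
  forall x, P x.
Proof.
move=> P0 PD PE x; rewrite -(mu_sum2 emu x).
apply: (big_ind P) => // i _; apply: (big_ind P) => // j _.
have [c ->] := scal i j x.
pose u := if i == j then e i i else symz (e i j).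
have Eu : E u by rewrite /u; case: eqP => _; [exact: mu_E|exact: symzE].
have -> : c *: e i j = (c *: e i i) ** u^# ** e j j.
  rewrite !cmulZl; congr (_ *: _); rewrite /u; case: eqVneq => [->|ij].
    by rewrite (mu_star emu) !(muMx emu).
  rewrite symz_mu cstarD !(mu_star emu) cmulDr (muM0 emu _ _ ij) add0r.
  by rewrite !(muMx emu).
by apply: PE => //; [apply/EZ/mu_E|exact: mu_E].
Qed.

End Scalar.

End Extension.

(** * Orthonormal families of arbitrary cardinality *)

Section OrthonormalFamily.
Set Implicit Arguments.
Unset Strict Implicit.
Variables (R : realType) (H : hilbertType R) (K : choiceType).
Local Open Scope ring_scope.
Local Open Scope classical_set_scope.
Local Open Scope complex_scope.
Import Order.TTheory GRing.Theory Num.Theory.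
Import numFieldNormedType.Exports.
Implicit Types (u v : K -> H) (x y z : H) (F : {fset K}).

Definition orthonormal u :=
  (forall k, inner (u k) (u k) = 1) /\ (forall k l, k != l -> inner (u k) (u l) = 0).

Lemma inner_suml (I : Type) (r : seq I) (P : pred I) (f : I -> H) z :
  inner (\sum_(i <- r | P i) f i) z = \sum_(i <- r | P i) inner (f i) z.
Proof.
by apply: (big_morph (fun x => inner x z)) => [x y|]; rewrite ?innerDl ?inner0l.
Qed.
Lemma inner_sumr (I : Type) (r : seq I) (P : pred I) (f : I -> H) z :
  inner z (\sum_(i <- r | P i) f i) = \sum_(i <- r | P i) inner z (f i).
Proof.
by apply: (big_morph (fun x => inner z x)) => [x y|]; rewrite ?innerDr ?inner0r.
Qed.

Definition fsum u (c : K -> R[i]) F : H := \sum_(k <- F) c k *: u k.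
Definition fnorm (c : K -> R[i]) F : R := \sum_(k <- F) complex.Re (c k * (c k)^*).

Lemma Re_sum (I : Type) (r : seq I) (f : I -> R[i]) :
  complex.Re (\sum_(i <- r) f i) = \sum_(i <- r) complex.Re (f i).
Proof. by apply: (big_morph (@complex.Re R)) => // -[? ?] []. Qed.

Lemma inner_fsum u c F k : orthonormal u ->
  inner (fsum u c F) (u k) = if k \in F then c k else 0.
Proof.
move=> [u1 u0]; rewrite inner_suml; case: ifPn => kF.
  rewrite (big_fsetD1 k)//= innerZl u1 mulr1 big1_seq ?addr0// => l /=.
  by rewrite !inE => /andP[lk _]; rewrite innerZl u0// mulr0.
rewrite big1_seq// => l /= lF; rewrite innerZl u0 ?mulr0//.
by apply: contraNneq kF => <-.
Qed.

Lemma fsum_norm u c F : orthonormal u -> rnorm (fsum u c F) ^+ 2 = fnorm c F.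
Proof.
move=> ou; transitivity (complex.Re (inner (fsum u c F) (fsum u c F))).
  by rewrite inner_rnorm.
rewrite {2}/fsum inner_sumr Re_sum; apply: eq_big_seq => k kF.
by rewrite innerZr inner_fsum// kF mulrC.
Qed.

Lemma bessel u x F : orthonormal u -> fnorm (fun k => inner x (u k)) F <= rnorm x ^+ 2.
Proof.
move=> ou; rewrite -(fsum_norm _ _ ou); set s := fsum _ _ _.
have xs : inner s (x - s) = 0.
  rewrite {1}/s /fsum inner_suml big1_seq// => k /= kF.
  rewrite innerZl innerBr [inner (u k) s]innerC inner_fsum// kF -innerC.
  by rewrite subrr mulr0.
by rewrite -[x in leRHS](subrK s) addrC rnormD_sqr xs mulr0 addr0 lerDl sqr_ge0.
Qed.

Lemma fsum_split u c F0 F : (F0 `<=` F)%fset ->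
  fsum u c F = fsum u c F0 + fsum u c (F `\` F0)%fset.
Proof.
move=> F0F; rewrite /fsum (big_fsetID _ (mem F0) F); congr (_ + _).
  apply: eq_fbigl => k; rewrite !inE/= andbC.
  by case: (boolP (k \in F0)) => //= /(fsubsetP F0F).
by apply: eq_fbigl => k; rewrite !inE/= andbC.
Qed.

Lemma fnorm_split c F0 F : (F0 `<=` F)%fset ->
  fnorm c F = fnorm c F0 + fnorm c (F `\` F0)%fset.
Proof.
move=> F0F; rewrite /fnorm (big_fsetID _ (mem F0) F); congr (_ + _).
  apply: eq_fbigl => k; rewrite !inE/= andbC.
  by case: (boolP (k \in F0)) => //= /(fsubsetP F0F).
by apply: eq_fbigl => k; rewrite !inE/= andbC.
Qed.

(** Unconditional summation, along the net of finite subsets, since [K] may be uncountable. *)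
Definition has_fsum u c y := forall e : R, 0 < e ->
  exists F0, forall F, (F0 `<=` F)%fset -> rnorm (y - fsum u c F) < e.

Definition totally : set_system {fset K} :=
  filter_from setT (fun F0 => [set F | (F0 `<=` F)%fset]).

#[local] Instance totally_filter : ProperFilter totally.
Proof.
apply: filter_from_proper => [|F _]; last by exists F => /=.
apply: filter_fromT_filter; first by exists fset0.
by move=> F G; exists (F `|` G)%fset => F' /=; rewrite fsubUset => /andP[].
Qed.

Lemma has_fsum_ex u c (M : R) : orthonormal u -> (forall F, fnorm c F <= M) ->
  exists y, has_fsum u c y.
Proof.
move=> ou cM; pose S := range (fnorm c).
have hS : has_sup S by split; [exists (fnorm c fset0), fset0|exists M => _ [F _ <-]].
(* [F0] nearly attains the supremum of [fnorm c]; by Pythagoras, whatever a larger set adds is then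
   short. *)
have tail e : 0 < e -> exists F0, forall F, (F0 `<=` F)%fset ->
    rnorm (fsum u c F0 - fsum u c F) < e.
  move=> e0; have [_ [F0 _ <-] F0e] := sup_adherent (exprn_gt0 2 e0) hS.
  exists F0 => F F0F; rewrite (fsum_split _ _ F0F) opprD addNKr rnormN.
  rewrite -(@ltr_pXn2r _ 2)// ?nnegrE ?rnorm_ge0 ?(ltW e0)// fsum_norm//.
  have : fnorm c F <= sup S by apply: sup_upper_bound => //; exists F.
  rewrite (fnorm_split _ F0F) => h; move: F0e.
  by rewrite ltrBlDr => /(le_lt_trans h); rewrite ltrD2l.
have cv : cvg (fsum u c @ totally).
  apply: cauchy_cvg; apply/cauchy_exP => e /realC_gt0[r r0 ->].
  have [F0 F0r] := tail _ r0; exists (fsum u c F0); exists F0 => // F /= /F0r.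
  by rewrite -ball_normE /= rnormE ltcR.
exists (lim (fsum u c @ totally)) => e e0.
have /cvgrPdist_lt/(_ e%:C) := cv; rewrite ltcR => /(_ e0)[F0 _ F0e].
by exists F0 => F /F0e /=; rewrite rnormE ltcR.
Qed.

Lemma has_fsum_uniq u c y z : has_fsum u c y -> has_fsum u c z -> y = z.
Proof.
move=> hy hz; apply/eqP; rewrite -subr_eq0; apply/eqP/rnorm0_eq0/eqP.
rewrite eq_le rnorm_ge0 andbT; apply: (@ler_small _ _ 2) => // e e0.
have [[F Fy] [G Gz]] := (hy _ e0, hz _ e0).
have {Fy} := Fy (F `|` G)%fset (fsubsetUl _ _).
have {Gz} := Gz (F `|` G)%fset (fsubsetUr _ _).
set s := fsum _ _ _ => zs ys; rewrite -(subrK s y) -addrA mulrC mulr_natl mulr2n.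
by rewrite (le_trans (ler_rnormD _ _))// lerD ?(ltW ys)// rnormB ltW.
Qed.

Lemma has_fsum_linear u c d (a : R[i]) y z : has_fsum u c y -> has_fsum u d z ->
  has_fsum u (fun k => a * c k + d k) (a *: y + z).
Proof.
move=> hy hz e e0; pose m := complex.Re `|a| + 1.
have a0 : 0 <= complex.Re `|a| by rewrite -ler0c RRe_real ?normr_real.
have m0 : 0 < m by rewrite ltr_wpDl.
have e2 : 0 < e / 2 by rewrite divr_gt0.
have [[F Fy] [G Gz]] := (hy _ (divr_gt0 e2 m0), hz _ e2).
exists (F `|` G)%fset => S; rewrite fsubUset => /andP[/Fy yS /Gz zS].
have -> : fsum u (fun k => a * c k + d k) S = a *: fsum u c S + fsum u d S.
  rewrite /fsum scaler_sumr -big_split; apply: eq_bigr => k _ /=.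
  by rewrite scalerDl scalerA.
rewrite opprD addrACA -scalerBr (le_lt_trans (ler_rnormD _ _))// [ltRHS](splitr e).
rewrite ler_ltD// rnormZ (@le_trans _ _ (m * rnorm (y - fsum u c S)))//.
  by rewrite ler_wpM2r ?rnorm_ge0// lerDl.
by move: yS; rewrite ltr_pdivlMr// mulrC => /ltW.
Qed.

Lemma has_fsum_le u c y (M : R) : 0 <= M -> orthonormal u ->
  (forall F, fnorm c F <= M ^+ 2) -> has_fsum u c y -> rnorm y <= M.
Proof.
move=> M0 ou cM hy; apply/ler_addgt0Pl => e e0; have [F /(_ F (fsubset_refl F)) yF] := hy _ e0.
rewrite -(subrK (fsum u c F) y) (le_trans (ler_rnormD _ _))// lerD ?(ltW yF)//.
by rewrite -(@ler_pXn2r _ 2) ?nnegrE ?rnorm_ge0// fsum_norm.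
Qed.

(** The partial isometry $x \mapsto \sum_k \langle x, u_k\rangle v_k$; Bessel's inequality makes the
    sum converge and the map contractive. *)
Lemma ex_orthonormal_map u v : orthonormal u -> orthonormal v ->
  exists V : bop H, (forall k, V (u k) = v k) /\
    (forall x, (forall k, inner x (u k) = 0) -> V x = 0).
Proof.
move=> ou ov; pose c x k := inner x (u k).
have ex x : exists y, has_fsum v (c x) y.
  by apply: (has_fsum_ex (M := rnorm x ^+ 2)) => // F; exact: bessel.
pose V x := sval (cid (ex x)).
have hV x : has_fsum v (c x) (V x) by rewrite /V; case: cid.
have VE x y : has_fsum v (c x) y -> V x = y by exact: has_fsum_uniq.
have lV : linear V.
  move=> a x y; apply: VE.
  rewrite (_ : c _ = fun k => a * c x k + c y k); first exact: has_fsum_linear.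
  by apply/funext => k; rewrite /c innerDl innerZl.
have bV x : rnorm (V x) <= 1 * rnorm x.
  rewrite mul1r; apply: has_fsum_le (hV x); rewrite ?rnorm_ge0// => F.
  exact: bessel.
exists (Bop (bounded_opP lV bV)); split=> [k|x xu] /=; apply: VE => e e0.
  exists [fset k]%fset => F; rewrite fsub1set => kF.
  rewrite /fsum (big_fsetD1 k)//= /c (proj1 ou) scale1r big1_seq ?addr0.
    by rewrite subrr rnorm0.
  by move=> l /=; rewrite !inE => /andP[lk _]; rewrite (proj2 ou) 1?eq_sym// scale0r.
exists fset0 => F _; rewrite /fsum big1 ?subr0 ?rnorm0// => k _.
by rewrite /c xu scale0r.
Qed.

End OrthonormalFamily.

Lemma card_le_inj (T : Type) (U : pointedType) (C : set T) (D : set U) :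
  card_le C D -> exists f : T -> U, (forall x, C x -> D (f x)) /\
    (forall x y, C x -> C y -> f x = f y -> x = y).
Proof.
move=> /pcard_leP[f]; exists f; split=> [x Cx|x y Cx Cy]; first exact: funS.
by apply: inj; rewrite inE.
Qed.

(** * Real orthonormal bases in rows and their matrix units *)

Section Frames.
Set Implicit Arguments.
Unset Strict Implicit.
Variables (R : realType) (H : hilbertType R) (J : conjugation H).
Local Open Scope ring_scope.
Local Open Scope classical_set_scope.
Import Order.TTheory GRing.Theory Num.Theory.
Implicit Types (x y z : H) (S T : bop H).

(* A real orthonormal basis arranged in rows indexed by ['I_n]. *)
Definition is_frame (K : choiceType) n (b : K -> 'I_n -> H) :=
  [/\ forall k i, J (b k i) = b k i, forall k i, inner (b k i) (b k i) = 1,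
      forall k i l j, (k, i) != (l, j) -> inner (b k i) (b l j) = 0 &
      forall x, (forall k i, inner x (b k i) = 0) -> x = 0].

Lemma bop_sum (I : Type) (r : seq I) (P : pred I) (f : I -> bop H) x :
  (\sum_(i <- r | P i) f i) x = \sum_(i <- r | P i) f i x.
Proof. by apply: (big_morph (fun S : bop H => S x)). Qed.

Lemma transposeK : involutive (transpose J).
Proof.
move=> S; apply: bop_eqP => x; rewrite transposeE.
have -> : adjoint (transpose J S) = transpose J (adjoint S) by rewrite transpose_adjoint.
by rewrite transposeE adjointK !conjHK.
Qed.

Section MatrixUnits.
Variables (K : choiceType) (n : nat) (b : K -> 'I_n -> H).
Hypothesis bP : is_frame b.

Let total x : (forall k i, inner x (b k i) = 0) -> x = 0.
Proof. by case: bP => _ _ _; apply. Qed.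

Let vext x y : (forall k i, inner x (b k i) = inner y (b k i)) -> x = y.
Proof.
move=> xy; apply/eqP; rewrite -subr_eq0; apply/eqP/total => k i.
by rewrite innerBl xy subrr.
Qed.

(** Passing to adjoints moves the operators onto frame vectors, where totality decides; this
    replaces a density argument. *)
Lemma frame_ext S T : (forall k i, S (b k i) = T (b k i)) -> S = T.
Proof.
move=> ST; apply: bop_eqP => x; apply: inner_ext => z.
rewrite -[S]adjointK -[T]adjointK -!adjointP.
congr (inner _ _); apply: vext => k i.
by rewrite ![inner (adjoint _ _) _]innerC -!adjointP ST.
Qed.

Let inner_frame k i l j : inner (b k i) (b l j) = ((k == l) && (i == j))%:R.
Proof.
case: bP => _ b1 b0 _; have [kl|kl] := eqVneq (k, i) (l, j).
  by case: kl => -> ->; rewrite !eqxx b1.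
by rewrite b0//; move: kl; rewrite xpair_eqE => /negPf ->.
Qed.

Let orthonormal_row i : orthonormal (b^~ i).
Proof. by split=> [k|k l /negPf kl]; rewrite inner_frame ?eqxx// kl. Qed.

Definition frame_unit i j : bop H :=
  sval (cid (ex_orthonormal_map (orthonormal_row j) (orthonormal_row i))).

Lemma frame_unit_orth i j x :
  (forall k, inner x (b k j) = 0) -> frame_unit i j x = 0.
Proof. by rewrite /frame_unit; case: cid => V /= [_]; apply. Qed.

Lemma frame_unitE i j k l :
  frame_unit i j (b k l) = if j == l then b k i else 0.
Proof.
case: eqVneq => [<-|jl].
  by rewrite /frame_unit; case: cid => V /= [-> _].
by apply: frame_unit_orth => m; rewrite inner_frame eq_sym [l == j]eq_sym (negPf jl) andbF.
Qed.

Lemma frame_unit_star i j : adjoint (frame_unit i j) = frame_unit j i.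
Proof.
apply: frame_ext => k l; apply: vext => m p.
rewrite innerC -adjointP !frame_unitE.
have conj01 (c : bool) : (c%:R : R[i])^* = c%:R by rewrite rmorph_nat.
case: (eqVneq j p) (eqVneq i l) => [<-|jp] [<-|il]; rewrite ?inner0l ?rmorph0//.
- by rewrite !inner_frame !eqxx !andbT conj01 eq_sym.
- by rewrite inner_frame (negPf il) andbF conj01.
- by rewrite inner_frame (negPf jp) andbF.
Qed.

Lemma frame_unitM i j k l :
  bop_comp (frame_unit i j) (frame_unit k l) = if j == k then frame_unit i l else 0.
Proof.
apply: frame_ext => m p; rewrite bop_compE !frame_unitE.
have [lp|lp] := eqVneq l p; rewrite ?bop0r ?frame_unitE.
  by case: eqVneq => _; rewrite ?frame_unitE ?lp ?eqxx.
by case: eqVneq => _; rewrite ?frame_unitE ?(negPf lp).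
Qed.

Let id_bounded : id \in @bounded_op R H.
Proof. by apply: (@bounded_opP _ _ _ 1) => // x; rewrite mul1r. Qed.

Lemma frame_matrix_units : matrix_units frame_unit.
Proof.
split=> [i j k l|i j|x]; [exact: frame_unitM|exact: frame_unit_star|].
rewrite -cmul_suml (_ : \sum_i _ = Bop id_bounded); first exact: bop_eqP.
apply: frame_ext => k i; rewrite bop_sum (bigD1 i)//= frame_unitE eqxx.
by rewrite big1 ?addr0// => j ji; rewrite frame_unitE (negPf ji).
Qed.

Lemma frame_unit_transpose i j : transpose J (frame_unit i j) = frame_unit j i.
Proof.
have bJ k l : J (b k l) = b k l by case: bP.
apply: frame_ext => k l; rewrite transposeE frame_unit_star bJ !frame_unitE.
by case: eqP => _; rewrite ?bJ ?conjH0.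
Qed.

Lemma frame_unit_scal : (forall k l : K, k = l) -> K -> forall i j (x : bop H),
  exists c : R[i], bop_comp (bop_comp (frame_unit i i) x) (frame_unit j j) =
    c *: frame_unit i j.
Proof.
move=> K1 k0 i j x; exists (inner (x (b k0 j)) (b k0 i)).
apply: frame_ext => k l; rewrite (K1 k k0) bopZl !bop_compE !frame_unitE.
case: eqVneq => _; last by rewrite !bop0r scaler0.
set y := x _; apply/eqP; rewrite -subr_eq0.
have <- : frame_unit i i (inner y (b k0 i) *: b k0 i) = inner y (b k0 i) *: b k0 i.
  by rewrite bopZr frame_unitE eqxx.
rewrite -bopBr; apply/eqP/frame_unit_orth => m.
by rewrite (K1 m k0) innerBl innerZl inner_frame !eqxx mulr1 subrr.
Qed.

End MatrixUnits.

Definition real_orthonormal (C : set H) :=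
  (forall c, C c -> J c = c /\ inner c c = 1) /\
  (forall c d, C c -> C d -> c <> d -> inner c d = 0).

(** Zorn's lemma gives a maximal real family. If x is orthogonal to it, then so are $x + Jx$ and
    $i(x - Jx)$; both are fixed by J, so maximality makes them vanish. *)
Lemma real_orthonormal_maximal : exists C, real_orthonormal C /\
  forall x, (forall c, C c -> inner x c = 0) -> x = 0.
Proof.
have [F FP Ftot|C [[C1 C0] Cmax]] := @Zorn_bigcup H real_orthonormal.
  split=> [c [X /FP[X1 _] /X1]//|c d [X FX Xc] [Y FY Yd]].
  case: (Ftot _ _ FX FY) => [/(_ _ Xc)|/(_ _ Yd)] h.
    by case: (FP _ FY) => _; exact.
  by case: (FP _ FX) => _; exact.
exists C; split=> // x xC.
have inner0C z w : inner z w = 0 -> inner w z = 0 by move=> zw; rewrite innerC zw rmorph0.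
have real0 y : J y = y -> (forall c, C c -> inner y c = 0) -> y = 0.
  move=> Jy yC; apply: contrapT => /eqP y0.
  have ny : rnorm y != 0 by apply: contra_neq y0; exact: rnorm0_eq0.
  pose u := ((rnorm y)^-1)%:C%C *: y.
  have uu : inner u u = 1.
    rewrite inner_rnorm rnormZr ger0_norm ?invr_ge0 ?rnorm_ge0// mulVf//.
    by rewrite expr1n.
  have uC c : C c -> inner u c = 0 by move=> Cc; rewrite innerZl yC// mulr0.
  have Cu : ~ C u by move=> /uC; rewrite uu => /eqP; rewrite oner_eq0.
  apply: (Cmax (C `|` [set u])).
    split; first exact: subsetUl.
    by move=> /(_ u)/(_ (or_intror erefl)).
  split=> [c [/C1//|->]|c d [Cc|->] [Cd|->]//].
  - split=> //; rewrite /u conjHZ Jy; congr (_ *: _); exact: conjc_real.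
  - exact: C0.
  - by move=> _; apply/inner0C/uC.
  - by move=> _; exact: uC.
have Jx c : C c -> inner (J x) c = 0.
  by move=> Cc; rewrite -(proj1 (C1 _ Cc)) inner_conjH; apply/inner0C/xC.
have e1 : x + J x = 0.
  apply: real0 => [|c Cc]; first by rewrite conjHD conjHK addrC.
  by rewrite innerDl xC// Jx// addr0.
have e2 : 'i%C *: (x - J x) = 0.
  apply: real0 => [|c Cc]; last by rewrite innerZl innerBl xC// Jx// subrr mulr0.
  have JN y : J (- y) = - J y by rewrite -scaleN1r conjHZ rmorphN rmorph1 scaleN1r.
  rewrite conjHZ conjHD JN conjHK -[J x - x]opprB scalerN -scaleNr; congr (_ *: _).
  by apply/eqP; rewrite eq_complex /= oppr0 opprK !eqxx.
have xJ : x = J x.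
  apply/eqP; rewrite -subr_eq0; move/eqP: e2; rewrite scaler_eq0 => /orP[|//].
  by rewrite -[_ == 0]/(_ == _) eq_complex /= oner_eq0 andbF.
move: e1; rewrite -xJ => /eqP; rewrite -mulr2n -scaler_nat scaler_eq0 pnatr_eq0 /=.
by move/eqP.
Qed.

(* Zorn's lemma, applied to families of disjoint injective sequences in [C],
   exhausts [C] up to a finite rest, which is prepended to one of the sequences. *)
Lemma infinite_rows (C : set H) : infinite_set C ->
  exists (K : choiceType) (b : K -> nat -> H),
    [/\ forall k m, C (b k m), forall k m l p, b k m = b l p -> (k, m) = (l, p) &
        forall c, C c -> exists k m, b k m = c].
Proof.
move=> Cinf.
pose P (G : set (nat -> H)) := (forall g, G g -> injective g /\ forall m, C (g m)) /\
  (forall g h m p, G g -> G h -> g m = h p -> g = h).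
have [F FP Ftot|G [[G1 G0] Gmax]] := @Zorn_bigcup _ P.
  split=> [g [X /FP[X1 _] /X1]//|g h m p [X FX Xg] [Y FY Yh]].
  case: (Ftot _ _ FX FY) => [/(_ _ Xg)|/(_ _ Yh)] h'.
    by case: (FP _ FY) => _; apply.
  by case: (FP _ FX) => _; apply.
pose rest := [set c | C c /\ forall g m, G g -> g m <> c].
have rest_fin : finite_set rest.
  apply: contrapT => /infiniteP/card_le_inj[f [frest finj]].
  have {}frest m : rest (f m) by exact: frest.
  have {}finj m p : f m = f p -> m = p by exact: finj.
  apply: (Gmax (G `|` [set f])).
    split; first exact: subsetUl.
    move=> /(_ f (or_intror erefl)) Gf.
    by have [_ /(_ f 0%N Gf)] := frest 0%N.
  split=> [g [/G1//|->]|g h m p [Gg|->] [Gh|->] //].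
  - by split=> [m p /finj//|m]; case: (frest m).
  - exact: G0.
  - by have [_ /(_ _ m Gg)] := frest p.
  - by have [_ /(_ _ p Gh)] := frest m => + /esym.
have [g0 Gg0] : exists g, G g.
  apply: contrapT => noG; apply: Cinf; apply: sub_finite_set rest_fin => c Cc.
  by split=> // g m Gg; case: noG; exists g.
have /finite_seqP[s' rs'] := rest_fin; pose s := undup s'.
have sP c : rest c <-> c \in s by rewrite rs' /= mem_undup.
have us : uniq s by exact: undup_uniq.
pose row (g : nat -> H) m := if pselect (g = g0) then
  (if (m < size s)%N then nth 0 s m else g0 (m - size s)%N) else g m.
have rowC g m : G g -> C (row g m).
  move=> Gg; rewrite /row; case: pselect => /= _; last by case: (G1 _ Gg).
  case: ltnP => [ms|_]; last by case: (G1 _ Gg0).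
  by have /sP[] := mem_nth 0 ms.
have restN g m p : G g -> (p < size s)%N -> g m <> nth 0 s p.
  by move=> Gg ps; have /sP[_] := mem_nth 0 ps; apply.
have row_inj g h m p : G g -> G h -> row g m = row h p -> g = h /\ m = p.
  move=> Gg Gh; rewrite /row.
  case: (pselect (g = g0)) => /= [eg|ng]; case: (pselect (h = g0)) => /= [eh|nh].
  - rewrite eg eh; case: (ltnP m) => ms; case: (ltnP p) => ps.
    + by move=> /eqP; rewrite nth_uniq// => /eqP.
    + by move=> /esym/(restN _ _ _ Gg0 ms).
    + by move=> /(restN _ _ _ Gg0 ps).
    + by move=> /(proj1 (G1 _ Gg0)) e; split=> //; rewrite -(subnK ms) e subnK.
  - case: ltnP => ps; first by move=> /esym e; case: (restN _ _ _ Gh ps e).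
    by move=> /esym/(G0 _ _ _ _ Gh Gg0)/nh.
  - case: ltnP => ps; first by move=> e; case: (restN _ _ _ Gg ps e).
    by move=> /(G0 _ _ _ _ Gg Gg0)/ng.
  - move=> e; have gh := G0 _ _ _ _ Gg Gh e; split=> //.
    by move: e; rewrite -gh => /(proj1 (G1 _ Gg)).
exists (set_type G), (fun g => row (set_val g)); split.
- by move=> [g Gg] m; apply: rowC; exact: set_mem.
- move=> g m h p /row_inj[||/val_inj -> ->]//; exact: set_valP.
- move=> c Cc; have [rc|] := pselect (rest c).
    exists (SigSub (mem_set Gg0)), (index c s); rewrite /row /=.
    by case: pselect => // /= _; rewrite index_mem (proj1 (sP c) rc) nth_index//; exact/sP.
  move=> nrc; have [g [m [Gg <-]]] : exists g m, G g /\ g m = c.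
    apply: contrapT => ngm; apply: nrc; split=> // g m Gg gmc.
    by apply: ngm; exists g, m.
  exists (SigSub (mem_set Gg)).
  have [gg0|ng] := pselect (g = g0).
    exists (m + size s)%N; rewrite /row /=; case: pselect => //= _.
    by rewrite ltnNge leq_addl /= addnK gg0.
  by exists m; rewrite /row /=; case: pselect.
Qed.

Lemma ex_frame (B : set H) : orthonormal_basis B ->
  (exists n (b : unit -> 'I_n -> H), is_frame b /\
     forall m, (`I_m #<= B)%card -> (m <= n)%N) \/
  (exists (K : choiceType) (b : K -> 'I_5 -> H), is_frame b).
Proof.
move=> [B1 B0 _]; have [C [[C1 C0] Ctot]] := real_orthonormal_maximal.
have [Cfin|Cinf] := pselect (finite_set C); [left|right].
  have /finite_seqP[s' Cs'] := Cfin; pose s := undup s'.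
  have us : uniq s by exact: undup_uniq.
  have Cs c : C c <-> c \in s by rewrite Cs' /= mem_undup.
  have Cnth (i : 'I_(size s)) : C (nth 0 s i) by apply/Cs/mem_nth.
  pose b (_ : unit) (i : 'I_(size s)) := nth 0 s i.
  exists (size s), b; split.
    split=> [k i|k i|[] i [] j ij|x xb].
    - exact: (proj1 (C1 _ (Cnth i))).
    - exact: (proj2 (C1 _ (Cnth i))).
    - apply: C0; [exact: Cnth|exact: Cnth|] => /eqP.
      rewrite nth_uniq// => /eqP/val_inj ij'.
      by move: ij; rewrite ij' eqxx.
    - apply: Ctot => c /Cs cs; rewrite -(nth_index 0 cs).
      have ci : (index c s < size s)%N by rewrite index_mem.
      exact: (xb tt (Ordinal ci)).
  move=> m /card_le_inj[f [fB finj]].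
  pose c (i : 'I_m) := f i.
  have cB i : B (c i) by apply: fB => /=.
  (* The Gram matrix of m distinct vectors of [B] is the identity, and it factors as [M *m N]
     through the frame vectors; comparing sizes bounds m. *)
  pose M := \matrix_(i < m, j < size s) inner (c i) (b tt j).
  pose N := \matrix_(j < size s, i < m) inner (b tt j) (c i).
  apply: (@mulmx1_min _ _ _ M N); apply/matrixP => i k; rewrite !mxE.
  have -> : (i == k)%:R = inner (c i) (c k).
    case: eqVneq => [->|ik]; first by rewrite B1.
    by rewrite B0// => /finj e; case/eqP: ik; apply/val_inj/e => /=.
  have cE : c i = \sum_j inner (c i) (b tt j) *: b tt j.
    apply/eqP; rewrite -subr_eq0; apply/eqP/Ctot => d /Cs ds.
    rewrite -(nth_index 0 ds); have di : (index d s < size s)%N by rewrite index_mem.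
    rewrite -[nth 0 s _]/(b tt (Ordinal di)) innerBl inner_suml (bigD1 (Ordinal di))//=.
    rewrite innerZl (proj2 (C1 _ (Cnth _))) mulr1 big1 ?addr0 ?subrr// => j jd.
    rewrite innerZl (C0 _ _ (Cnth _) (Cnth _)) ?mulr0// => /eqP; rewrite nth_uniq//= => /eqP jE.
    by move: jd; rewrite -val_eqE /= jE eqxx.
  rewrite cE inner_suml; apply: eq_bigr => j _.
  by rewrite !mxE innerZl.
have [K [b [bC binj bsurj]]] := infinite_rows Cinf.
(* Euclidean division by 5 distributes each sequence over five rows. *)
exists (K * nat)%type, (fun k i => b k.1 (k.2 * 5 + i)%N); split.
- by move=> k i; case: (C1 _ (bC k.1 (k.2 * 5 + i)%N)).
- by move=> k i; case: (C1 _ (bC k.1 (k.2 * 5 + i)%N)).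
- move=> [k m] i [l p] j /= kl; apply: C0; [exact: bC|exact: bC|] => /binj[kl' e].
  rewrite kl' in kl.
  have mp : m = p.
    by have := congr1 (fun q => q %/ 5)%N e; rewrite !divnMDl// !divn_small ?addn0.
  by move: kl e; rewrite mp xpair_eqE eqxx /= => + /addnI/val_inj => /eqP.
- move=> x xb; apply: Ctot => c /bsurj[k [m <-]].
  by rewrite (divn_eq m 5); exact: (xb (k, m %/ 5)%N (Ordinal (ltn_pmod m (isT : 0 < 5)%N))).
Qed.

End Frames.

(** * Universal property and reversibility from algebraic data *)

Section UniversalTRO.
Set Implicit Arguments.
Unset Strict Implicit.
Variables (R : realType) (A : cstarAlgType R).
Local Open Scope ring_scope.
Local Open Scope classical_set_scope.
Import GRing.Theory Num.Theory.
Local Notation "a ** b" := (cmul a b) (at level 40, left associativity).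
Local Notation "a ^#" := (cstar a) (at level 2, format "a ^#").

(** Stronger than generation in the sense of [smallest]: finite sums of single triple products
    already exhaust [A]. The form is that of an induction principle. *)
Definition tro_generated (E : set A) := forall P : set A, P 0 ->
  (forall x y, P x -> P y -> P (x + y)) ->
  (forall x y z, E x -> E y -> E z -> P (tro_prod x y z)) -> forall x, P x.

Definition tro_extendable (E : set A) := forall (D : cstarAlgType R) (pi : A -> D),
  linear_on E pi ->
  (forall x y z, E x -> E y -> E z ->
    pi (jordan_prod x y z) = jordan_prod (pi x) (pi y) (pi z)) ->
  exists f : A -> D, [/\ linear f,
    forall x y z, f (tro_prod x y z) = tro_prod (f x) (f y) (f z) &
    forall x, E x -> f x = pi x].

Lemma is_TRO_D (B : cstarAlgType R) (T : set B) x y : is_TRO T -> T x -> T y -> T (x + y).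
Proof. by move=> [[_ TZ] _ _] Tx Ty; rewrite -[x]scale1r; exact: TZ. Qed.

Lemma full_universal_TRO (E : JC_triple A) :
  tro_generated E -> tro_extendable E -> is_universal_TRO E (full_TRO A) id.
Proof.
move=> gen ext; split=> //.
- apply/seteqP; split=> // x _ T [TT ET]; apply: gen.
  + by case: TT => -[].
  + by move=> y z; exact: is_TRO_D.
  + move=> y z w Ey Ez Ew; case: TT => _ _; apply; apply: ET; by [exists y|exists z|exists w].
- move=> D S pi [pil piS pij].
  have [f [fl fM fpi]] := ext D pi pil pij.
  have fD := linear_funD fl; have f0 := linear_fun0 fl.
  exists f; split.
  + split=> [k a b _ _|x _|//]; first exact: fl.
    suff /(_ x) : forall x, (fun x => tro_set S (f x)) x by [].
    apply: (gen (fun x => tro_set S (f x))) => [|y z|y z w Ey Ez Ew]; rewrite ?f0 ?fD ?fM.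
    * by case: (TROP S) => -[].
    * by move=> Sy Sz; exact: is_TRO_D (TROP S) Sy Sz.
    * by rewrite !fpi//; case: (TROP S) => _ _; apply; exact: piS.
  + by move=> x /set_mem/fpi.
  + move=> g [gl _ gM] gpi x _.
    have gD y z : g (y + z) = g y + g z by rewrite -[y in LHS]scale1r gl// scale1r.
    have g0 : g 0 = 0 by apply: (@addrI _ (g 0)); rewrite -gD !addr0.
    suff /(_ x) : forall x, (fun x => g x = f x) x by [].
    apply: (gen (fun x => g x = f x)) => [|y z yE zE|y z w Ey Ez Ew]; first by rewrite g0 f0.
      by rewrite gD fD yE zE.
    have gf u : JC_set E u -> g u = f u by move=> Eu; rewrite fpi// -gpi//; exact: mem_set.
    by rewrite gM// fM !gf.
Qed.

Lemma eq_alt_prod (B : cstarAlgType R) (a b : nat -> B) k :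
  (forall i, (i <= k.*2)%N -> a i = b i) -> alt_prod a k = alt_prod b k.
Proof.
elim: k => [|k IHk] ab /=; first exact: ab.
rewrite IHk => [|i ik]; first by rewrite !ab ?doubleS.
by apply: ab; rewrite doubleS (leq_trans ik)// -addn2 leq_addr.
Qed.

Lemma tro_prodA (a b c d x : A) :
  tro_prod (tro_prod a b c) d x = tro_prod a b (tro_prod c d x).
Proof. by rewrite /tro_prod !cmulA. Qed.

Lemma alt_prod_head (a : nat -> A) k : alt_prod a k.+1 =
  tro_prod (a 0%N) (a 1%N) (alt_prod (fun i => a i.+2) k).
Proof.
elim: k => [//|k IHk]; rewrite [LHS]/= -/(alt_prod a k.+1) IHk /= tro_prodA.
by rewrite doubleS.
Qed.

(** The universal property extends any other embedding [alpha] to a TRO homomorphism [f], which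
    carries alternating products over [E] to those over the image of [alpha]. *)
Lemma full_reversible_universal (E : JC_triple A) :
  is_universal_TRO E (full_TRO A) id -> reversible E -> universally_reversible E.
Proof.
move=> uE revE; split; first by exists A, (full_TRO A), id.
move=> B T alpha [alphaP _ _ _]; case: (uE) => _ _ _ /(_ B T alpha alphaP).
move=> [f [[fl _ fM] falpha _]] k c k1 cE.
have fE x : JC_set E x -> f x = alpha x by move=> Ex; apply: falpha; exact: mem_set.
have falt b j : f (alt_prod b j) = alt_prod (f \o b) j.
  by elim: j => //= j IHj; rewrite fM// IHj.
have : forall i, exists x, (i <= k.*2)%N -> JC_set E x /\ f x = c i.
  move=> i; have [ik|ik] := boolP (i <= k.*2)%N; last by exists 0.
  by have [x Ex <-] := cE i ik; exists x; rewrite fE.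
move=> /choice[a aP]; exists (alt_prod a k + alt_prod (fun i => a (k.*2 - i)%N) k).
  by apply: revE => // i /aP[].
rewrite -fE; last by apply: revE => // i /aP[].
rewrite -[X in f (X + _)]scale1r fl// scale1r !falt; congr (_ + _).
  by apply: eq_alt_prod => i /aP[].
by apply: eq_alt_prod => i ik; case: (aP (k.*2 - i)%N (leq_subr _ _)).
Qed.

Variables (t : A -> A) (eps : R[i]).
Hypothesis t_linear : linear t.
Hypothesis tK : involutive t.
Hypothesis tM : forall x y, t (x ** y) = t y ** t x.
Hypothesis t_star : forall x, t x^# = (t x)^#.
Hypothesis eps1 : eps = 1 \/ eps = -1.

(** The sign [eps] is collected 2k+1 times, an odd number, hence counts once. *)
Lemma t_alt_prod a k : (forall i, (i <= k.*2)%N -> t (a i) = eps *: a i) ->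
  t (alt_prod a k) = eps *: alt_prod (fun i => a (k.*2 - i)%N) k.
Proof.
elim: k => [|k IHk] aE; first by rewrite /= aE.
have ak i : (i <= k.*2)%N -> t (a i) = eps *: a i.
  by move=> ik; apply: aE; rewrite doubleS (leq_trans ik)// -addn2 leq_addr.
rewrite [in RHS]alt_prod_head doubleS /= /tro_prod !tM t_star IHk// !aE ?doubleS//.
rewrite cstarZ (eps_conj eps1) !(cmulZl, cmulZr) (epsZK eps1) subn0 subSS subn0 cmulA.
by congr (_ *: (_ ** _)); apply: eq_alt_prod => i _; rewrite !subSS.
Qed.

Lemma eigen_reversible : reversible [set x | t x = eps *: x].
Proof.
move=> k a _ aE /=; rewrite (linear_funD t_linear) scalerDr t_alt_prod// addrC.
congr (_ + _); rewrite t_alt_prod => [|i _]; last by apply: aE; exact: leq_subr.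
by congr (_ *: _); apply: eq_alt_prod => i ik; rewrite subKn.
Qed.

End UniversalTRO.

(** * Assembling the cases *)

Section Eigenspaces.
Set Implicit Arguments.
Unset Strict Implicit.
Variables (R : realType) (H : hilbertType R) (J : conjugation H).
Local Open Scope ring_scope.
Local Open Scope classical_set_scope.
Import GRing.Theory Num.Theory.

Lemma eigen_universal (K : choiceType) n (b : K -> 'I_n -> H) (eps : R[i])
    (E : JC_triple (bop H)) : is_frame J b -> eps = 1 \/ eps = -1 ->
  JC_set E = [set x | transpose J x = eps *: x] ->
  (4 < n)%N \/ [/\ eps = 1, (0 < n)%N, (forall k l : K, k = l) & inhabited K] ->
  universally_reversible E /\ is_universal_TRO E (full_TRO (bop H)) id.
Proof.
move=> bP eps1 EE nP.
have emu := frame_matrix_units bP.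
have te := frame_unit_transpose bP.
have tl : linear (transpose J) by exact: transpose_linear.
have tK := transposeK J.
have tM := transpose_antimul J.
have ts := transpose_adjoint J.
have uE : is_universal_TRO E (full_TRO (bop H)) id.
  case: nP => [n5|[e1 n0 K1 [k0]]].
    apply: full_universal_TRO; rewrite EE; last move=> D pi pil pij.
      exact: (generic_generated emu tl tK tM te eps1 n5).
    exact: (generic_extension emu tl tK tM ts te eps1 pil pij n5).
  have sc := frame_unit_scal bP K1 k0.
  apply: full_universal_TRO; rewrite EE; last move=> D pi pil pij.
    exact: (scalar_generated emu tl tK te eps1 e1 sc).
  exact: (scalar_extension emu tl tK tM ts te eps1 pil pij e1 sc (Ordinal n0)).
split=> //; apply: full_reversible_universal => //.
by rewrite EE; exact: eigen_reversible tl tM ts eps1.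
Qed.

End Eigenspaces.

Theorem theorem5p5 (R : realType) (H : hilbertType R) (J : conjugation H)
    (B : set H) (onbB : orthonormal_basis B) (E : JC_triple (bop H))
    (hE : (E = sym_triple J /\ `I_2 #<= B) \/
          (E = skew_triple J /\ `I_5 #<= B)) :
  universally_reversible E /\ is_universal_TRO E (full_TRO (bop H)) id.
Proof.
have symE : JC_set (sym_triple J) = [set x | transpose J x = (1 *: x)%R].
  by apply/seteqP; split=> x /=; rewrite GRing.scale1r.
have skewE : JC_set (skew_triple J) = [set x | transpose J x = (-1 *: x)%R].
  by apply/seteqP; split=> x /=; rewrite GRing.scaleN1r.
case: (ex_frame J onbB) => [[n [b [bP nB]]]|[K [b bP]]].
  case: hE => -[-> /nB n_ge].
    (* In finite dimension S_n takes the scalar route for every n, also for n >= 5. *)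
    apply: (eigen_universal bP (or_introl erefl) symE); right.
    by split; [|exact: ltnW|case=> -[]|exists; exact: tt].
  by apply: (eigen_universal bP (or_intror erefl) skewE); left.
case: hE => -[-> _].
  by apply: (eigen_universal bP (or_introl erefl) symE); left.
by apply: (eigen_universal bP (or_intror erefl) skewE); left.
Qed.
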